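(* Fix $y\in(0,1)$. Let $\{\mathcal{C}_n\}$ be a sequence of binary linear codes, $\mathcal{C}_n$ of length $n$ with dual distance $d_n^\bot$, and let $p_n$ be positive integers with $p_n/n=y$. Let $\widetilde{\Phi}_{\mathcal{C}_n}$ be the $p_n\times n$ random matrix whose rows are drawn independently and uniformly from $\mathcal{C}_n$ (entries $0,1$ regarded as real numbers), let $\widetilde{\mathcal{G}}_{\mathcal{C}_n}=\frac{4}{n}\widetilde{\Phi}_{\mathcal{C}_n}\widetilde{\Phi}_{\mathcal{C}_n}^T$, and let $\tilde{\lambda}_1$ be the largest eigenvalue of $\widetilde{\mathcal{G}}_{\mathcal{C}_n}$. If $d_n^\bot\geq 5$ for all $n$, then as $n\to\infty$, $\tilde{\lambda}_1-(p_n+1+y)$ converges in distribution to the Gaussian distribution with mean $0$ and variance $4y$.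
   Context: A binary linear code of length $n$ is a linear subspace $\mathcal{C}\subset\mathbb{F}_2^n$; its dual $\mathcal{C}^\bot$ is its orthogonal complement for the standard inner product on $\mathbb{F}_2^n$; the dual distance $d^\bot$ is the minimum Hamming distance of $\mathcal{C}^\bot$ (so $d^\bot\ge k$ means every nonzero codeword of $\mathcal{C}^\bot$ has Hamming weight at least $k$). The index $n$ ranges over those positive integers for which $p_n=yn$ is an integer. *)

(* Defs.v *)
From HB Require Import structures.
From mathcomp Require Import all_boot all_order all_algebra.
From mathcomp Require Import all_classical all_reals all_analysis.

Set Implicit Arguments.
Unset Strict Implicit.
Unset Printing Implicit Defensive.

Import Order.TTheory GRing.Theory Num.Theory.
Import numFieldNormedType.Exports.

Local Open Scope classical_set_scope.
Local Open Scope ring_scope.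

Definition hamming_dist (n : nat) (u v : 'rV['F_2]_n) : nat :=
  #|[pred i | u 0 i != v 0 i]|.

                                                                              
                                                                             
Definition min_distance (R : realType) (n : nat) (D : set 'rV['F_2]_n) :
    \bar R :=
  ereal_inf [set z | exists u v, [/\ D u, D v, u != v &
                                    z = ((hamming_dist u v)%:R)%:E]].

Definition dual_code (n : nat) (C : {vspace 'rV['F_2]_n}) :
    set 'rV['F_2]_n :=
  [set v : 'rV['F_2]_n | forall u : 'rV['F_2]_n, u \in C ->
    \sum_(i < n) u 0 i * v 0 i = 0].

Definition dual_distance (R : realType) (n : nat) (C : {vspace 'rV['F_2]_n}) :
    \bar R :=
  min_distance R (dual_code C).

                                                                              
                                                      
Definition independent_family (R : realType) (d : measure_display)
    (T : measurableType d) (P : probability T R) (I A : finType)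
    (X : I -> T -> A) : Prop :=
  forall (J : {set I}) (B : I -> set A),
    P (\bigcap_(i in [set` J]) X i @^-1` B i) =
    (\prod_(i in J) P (X i @^-1` B i))%E.

Definition iid_uniform_rows (R : realType) (d : measure_display)
    (T : measurableType d) (P : probability T R) (p n : nat)
    (C : {vspace 'rV['F_2]_n}) (Phi : T -> 'M['F_2]_(p, n)) : Prop :=
  [/\ forall i u, measurable [set w | row i (Phi w) = u],
      forall i u, P [set w | row i (Phi w) = u] =
                  (if u \in C then (#|C|%:R)^-1 else 0)%:E
    & independent_family P (fun i w => row i (Phi w))].

Definition real_mx (R : realType) (p n : nat) (M : 'M['F_2]_(p, n)) :
    'M[R]_(p, n) :=
  map_mx (fun x : 'F_2 => (nat_of_ord x)%:R) M.

Definition code_gram (R : realType) (p n : nat) (M : 'M['F_2]_(p, n)) :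
    'M[R]_p :=
  (4 / n%:R) *: (real_mx R M *m (real_mx R M)^T).

                                                                        
                                                   
Definition largest_eigenvalue (R : realType) (p : nat) (M : 'M[R]_p) : R :=
  sup [set a | eigenvalue M a].

                                                             
Definition cvg_in_distribution (R : realType) (I : Type) (F : set_system I)
    (d : I -> measure_display) (T : forall i, measurableType (d i))
    (P : forall i, probability (T i) R) (X : forall i, T i -> R)
    (mu : probability (measurableTypeR R) R) : Prop :=
  (\forall i \near F, measurable_fun [set: T i] (X i)) /\
  forall x : R, {for x, continuous (fun t : R => mu `]-oo, t]%classic)} ->
    P i (X i @^-1` `]-oo, x]%classic) @[i --> F] --> mu `]-oo, x]%classic.

Definition admissible_lengths (R : realType) (y : R) : set nat :=
  [set n | (0 < n)%N /\ y * n%:R \is a Num.int].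

(* Main.v *)
From HB Require Import structures.
Require Import Defs.
From mathcomp Require Import all_boot all_order all_algebra.
From mathcomp Require Import all_classical all_reals all_analysis.
From mathcomp Require Import ring lra.

Import Order.TTheory GRing.Theory Num.Theory.
Import numFieldNormedType.Exports.

Local Open Scope classical_set_scope.
Local Open Scope ring_scope.

(* Write the bits as (1 - eps)/2 with signs eps, let a_i be the average of the
   signs in row i and G the Gram matrix E E^T / n of the sign matrix E.  Then the
   Gram matrix of the code is J - a 1^T - 1 a^T + G: a rank-one perturbation of
   size p of a matrix whose operator norm is o(p).  Hence the top eigenvalue is
   the Rayleigh quotient of the all-one vector, p + 1 - 2 sum_i a_i + o(1), plus
   the second-order term |a|^2, which concentrates around y; only second and
   fourth moments enter, and dual distance at least 5 makes any four coordinates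
   of a random codeword behave as independent fair bits.  The sum -2 sum_i a_i of
   independent variables is asymptotically N(0, 4y) by Stein's method: with Phi
   the Gaussian distribution function, phi its density and K a primitive of k
   vanishing at 0 and 1, f = K(Phi)/phi solves s^2 f' - x f = s^2 k(Phi), so that
   Phi(sum) becomes uniform on [0, 1]. *)

Set Implicit Arguments.
Unset Strict Implicit.
Unset Printing Implicit Defensive.

(** * Expectation over a finite product space *)

Section FiniteProductExpectation.
Variables (R : realType) (A I : finType) (w : A -> R).
Hypotheses (w_ge0 : forall z, 0 <= w z) (w_sum1 : \sum_z w z = 1).

(** A code has finitely many words, so the random part is a weighted finite sum over configurations
    of rows; the given probability spaces enter only at the end, through the probability of each
    configuration. Dual distance 5 gives access to four-point moments only, hence concentration is
    in mean square throughout. This suffices: the off-diagonal part of G has mean squared Frobenius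
    norm at most p^2/n, which is of order p, so its operator norm is of order sqrt p, negligible
    against the top eigenvalue. All squared fluctuations, each divided by its tolerated size, are
    added into one quantity of mean O(1/n), and a single Markov bound covers them. Pulling test
    functions back by the Gaussian distribution function turns Gaussian integrals into integrals
    over [0, 1]; half-lines become initial segments of [0, 1], which are approximated by piecewise
    linear ramps whose means are explicit. Every error bound is uniform over codes of a given
    length, so the variation of the code with n is harmless. *)

Definition mean (f : A -> R) : R := \sum_z w z * f z.

Definition prod_mean (F : {ffun I -> A} -> R) : R :=
  \sum_(X : {ffun I -> A}) (\prod_i w (X i)) * F X.

Definition resample (X : {ffun I -> A}) (i : I) (z : A) : {ffun I -> A} :=
  [ffun j => if j == i then z else X j].

Lemma resample_same X i z : resample X i z i = z.
Proof. by rewrite ffunE eqxx. Qed.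

Lemma resample_other X i z j : j != i -> resample X i z j = X j.
Proof. by rewrite ffunE => /negbTE ->. Qed.

(* The map (X, z) |-> (X with z at i, X i) is an involution preserving the
   weight. *)
Lemma prod_mean_resample i F :
  prod_mean F = prod_mean (fun X => mean (fun z => F (resample X i z))).
Proof.
rewrite /prod_mean /mean.
under [RHS]eq_bigr do rewrite big_distrr/=.
rewrite pair_big/=.
pose sw (q : {ffun I -> A} * A) := (resample q.1 i q.2, q.1 i).
have swK : involutive sw.
  case=> X z; rewrite /sw/= resample_same; congr pair.
  by apply/ffunP => j; rewrite !ffunE; case: eqVneq => [->|].
rewrite (reindex_inj (inv_inj swK))/=.
transitivity (\sum_(q : {ffun I -> A} * A)
    (\prod_j w (q.1 j)) * F q.1 * w q.2).
  rewrite -(pair_big xpredT xpredT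
    (fun (X : {ffun I -> A}) z => (\prod_j w (X j)) * F X * w z))/=.
  by apply: eq_bigr => X _; rewrite -big_distrr/= w_sum1 mulr1.
apply: eq_bigr => -[X z] _ /=.
have -> : resample (resample X i z) i (X i) = X.
  by have := congr1 fst (swK (X, z)).
rewrite (bigD1 i)//= [in RHS](bigD1 i)//= resample_same.
under [in RHS]eq_bigr => j ji do rewrite resample_other//.
by ring.
Qed.

Lemma eq_prod_mean F F' : F =1 F' -> prod_mean F = prod_mean F'.
Proof. by move=> FF'; apply: eq_bigr => X _; rewrite FF'. Qed.

Lemma eq_mean f f' : f =1 f' -> mean f = mean f'.
Proof. by move=> ff'; apply: eq_bigr => X _; rewrite ff'. Qed.

Lemma prod_weight_ge0 (X : {ffun I -> A}) : 0 <= \prod_i w (X i).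
Proof. exact: prodr_ge0. Qed.

Lemma ler_prod_mean F F' :
  (forall X, F X <= F' X) -> prod_mean F <= prod_mean F'.
Proof.
by move=> FF'; apply: ler_sum => X _; rewrite ler_wpM2l// prod_weight_ge0.
Qed.

Lemma ler_mean f f' : (forall z, f z <= f' z) -> mean f <= mean f'.
Proof. by move=> ff'; apply: ler_sum => X _; rewrite ler_wpM2l. Qed.

Lemma mean_cst c : mean (fun=> c) = c.
Proof. by rewrite /mean -big_distrl/= w_sum1 mul1r. Qed.

Lemma meanZ c f : mean (fun z => c * f z) = c * mean f.
Proof. by rewrite /mean big_distrr/=; apply: eq_bigr => z _; ring. Qed.

Lemma meanD f g : mean (fun z => f z + g z) = mean f + mean g.
Proof. by rewrite /mean -big_split/=; apply: eq_bigr => z _; ring. Qed.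

Lemma mean_sum (J : finType) (Q : pred J) (f : J -> A -> R) :
  mean (fun z => \sum_(j | Q j) f j z) = \sum_(j | Q j) mean (f j).
Proof.
rewrite /mean exchange_big/=; apply: eq_bigr => z _.
by rewrite big_distrr.
Qed.

Lemma prod_mean_cst c : prod_mean (fun=> c) = c.
Proof.
rewrite /prod_mean -big_distrl/= -(bigA_distr_bigA (fun (_ : I) z => w z)).
by rewrite big1 ?mul1r.
Qed.

Lemma prod_meanZ c F : prod_mean (fun X => c * F X) = c * prod_mean F.
Proof. by rewrite /prod_mean big_distrr/=; apply: eq_bigr => z _; ring. Qed.

Lemma prod_meanD F G :
  prod_mean (fun X => F X + G X) = prod_mean F + prod_mean G.
Proof. by rewrite /prod_mean -big_split/=; apply: eq_bigr => z _; ring. Qed.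

Lemma prod_meanB F G :
  prod_mean (fun X => F X - G X) = prod_mean F - prod_mean G.
Proof.
rewrite -(mulN1r (prod_mean G)) -prod_meanZ -prod_meanD.
by apply: eq_prod_mean => X; ring.
Qed.

Lemma prod_mean_sum (J : finType) (Q : pred J) (F : J -> {ffun I -> A} -> R) :
  prod_mean (fun X => \sum_(j | Q j) F j X) = \sum_(j | Q j) prod_mean (F j).
Proof.
rewrite /prod_mean exchange_big/=; apply: eq_bigr => z _.
by rewrite big_distrr.
Qed.

Lemma ler_norm_prod_mean F : `|prod_mean F| <= prod_mean (fun X => `|F X|).
Proof.
rewrite /prod_mean (le_trans (ler_norm_sum _ _ _))//.
by apply: ler_sum => X _; rewrite normrM ger0_norm// prod_weight_ge0.
Qed.

(** Invariance under [resample] at [i] encodes that [h] does not depend on coordinate [i]. Once that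
    coordinate is redrawn, [h X] is a constant factor of the inner mean. *)
Lemma prod_mean_indep i f h :
  (forall X z, h (resample X i z) = h X) ->
  prod_mean (fun X => f (X i) * h X) = mean f * prod_mean h.
Proof.
move=> hi; rewrite (prod_mean_resample i) -prod_meanZ; apply: eq_prod_mean => X.
transitivity (mean (fun z => h X * f z)); last by rewrite meanZ mulrC.
by apply: eq_mean => z; rewrite resample_same hi mulrC.
Qed.

Lemma prod_mean_coord i f : prod_mean (fun X => f (X i)) = mean f.
Proof.
rewrite -[RHS]mulr1 -(prod_mean_cst 1) -(@prod_mean_indep i _ (fun=> 1))//.
by apply: eq_prod_mean => X; rewrite mulr1.
Qed.

(** Pythagoras in L^2. The index type [J] is arbitrary because the lemma serves both sums over rows
    and sums over pairs of rows. *)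
Lemma prod_mean_sqr_sum (J : finType) (Q : pred J) (Y : J -> {ffun I -> A} ->
  R) :
  (forall s t, Q s -> Q t -> s != t -> prod_mean (fun X => Y s X * Y t X) = 0)
    ->
  prod_mean (fun X => (\sum_(j | Q j) Y j X) ^+ 2) =
  \sum_(j | Q j) prod_mean (fun X => Y j X ^+ 2).
Proof.
move=> Yorth.
transitivity (prod_mean (fun X => \sum_(s | Q s) \sum_(t | Q t) Y s X * Y t X)).
  apply: eq_prod_mean => X; rewrite expr2 big_distrl/=.
  by apply: eq_bigr => s _; rewrite big_distrr.
rewrite prod_mean_sum; apply: eq_bigr => s Qs.
rewrite prod_mean_sum (bigD1 s)//= big1 ?addr0// => t /andP[Qt ts].
by rewrite Yorth// eq_sym.
Qed.

End FiniteProductExpectation.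

(** * The Gaussian distribution function and Stein's equation *)

Lemma mean_value (R : realType) (f df : R -> R) (a b : R) : a <= b ->
  (forall x : R, a <= x <= b -> is_derive x 1 f (df x)) ->
  exists2 c, a <= c <= b & f b - f a = df c * (b - a).
Proof.
move=> ab fdf; have [||c] := @MVT_segment R f df a b ab.
- by move=> x; rewrite in_itv/= => /andP[ax xb]; apply: fdf; rewrite !ltW.
- apply: derivable_within_continuous => x; rewrite in_itv/= => xab.
  exact: @ex_derive _ _ _ _ _ _ _ (fdf x xab).
- by rewrite in_itv/= => cab ->; exists c.
Qed.

(** The endpoints are unordered, and the intermediate point stays within [|v - u|] of [u]; the
    second-order estimate in [stein_bounds] relies on that localisation. *)
Lemma mean_value_norm (R : realType) (f df : R -> R) (u v : R) :
  (forall x : R, is_derive x 1 f (df x)) ->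
  exists2 c, `|c - u| <= `|v - u| & f v - f u = df c * (v - u).
Proof.
move=> fdf; have [uv|/ltW vu] := leP u v.
- have [c /andP[uc cv] ->] := mean_value uv (fun x _ => fdf x); exists c => //.
  by rewrite !ger0_norm ?subr_ge0// lerD2r.
- have [c /andP[vc cu] E] := mean_value vu (fun x _ => fdf x); exists c.
  + by rewrite !ler0_norm ?subr_le0// lerN2 lerD2r.
  + by rewrite -opprB E -mulrN opprB.
Qed.

Section Gaussian.
Variables (R : realType) (s : R).
Hypothesis s_gt0 : 0 < s.

Let s_neq0 : s != 0. Proof. by rewrite gt_eqF. Qed.

Definition gauss_cdf (t : R) : R := fine (normal_prob 0 s `]-oo, t]).

Local Notation phi := (normal_pdf 0 s).
Local Notation Phi := gauss_cdf.

Lemma gauss_pdf_gt0 x : 0 < phi x.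
Proof.
by rewrite normal_pdfE// mulr_gt0 ?normal_peak_gt0// expR_gt0.
Qed.

Lemma is_derive_gauss_pdf (x : R) : is_derive x 1 phi (- (x / s ^+ 2) * phi x).
Proof.
rewrite normal_pdfE// /normal_fun.
apply: is_derive_eq.
rewrite /GRing.scale/=.
by field; rewrite s_neq0.
Qed.

Lemma is_derive_gauss_cdf (x : R) : is_derive x 1 Phi (phi x).
Proof.
have [||||dF F'] := @continuous_FTC1 R phi -oo%O x (x + 1).
- by rewrite ltrDl.
- apply: (integrableS measurableT) => //; exact: integrable_normal_pdf.
- by rewrite ltNyr.
- exact: continuous_normal_pdf.
by split => //; rewrite -derive1E.
Qed.

Lemma gauss_cdf_lipschitz u v : `|Phi u - Phi v| <= normal_peak s * `|u - v|.
Proof.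
have [c _ ->] := mean_value_norm v u is_derive_gauss_cdf.
rewrite normrM ler_wpM2r// ger0_norm ?normal_pdf_ge0//.
exact: normal_pdf_ub.
Qed.

Lemma gauss_cdf_ge0 x : 0 <= Phi x.
Proof. by rewrite fine_ge0. Qed.

Lemma gauss_cdf_le1 x : Phi x <= 1.
Proof.
by rewrite -[1]/(fine 1%E) fine_le ?fin_num_measure// probability_le1.
Qed.

Lemma gauss_cdf_nd : {homo Phi : x z / x <= z}.
Proof.
move=> x z xz; rewrite fine_le ?fin_num_measure// le_measure ?inE//.
exact: subitvPr.
Qed.

Let idR : measurableTypeR R -> R := idfun.

#[local] HB.instance Definition _ :=
  @isMeasurableFun.Build _ _ _ _ idR (@measurable_id _ _ setT).

Lemma gauss_cdf_cvgNy : Phi x @[x --> -oo] --> (0 : R).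
Proof. exact: fine_cvg (@cvg_cdfNy0 _ _ _ (normal_prob 0 s) idR). Qed.

Lemma gauss_cdf_cvgy : Phi x @[x --> +oo] --> (1 : R).
Proof. exact: fine_cvg (@cvg_cdfy1 _ _ _ (normal_prob 0 s) idR). Qed.

Lemma gauss_pdf_even x : phi (- x) = phi x.
Proof. by rewrite normal_pdfE// /normal_fun !subr0 sqrrN. Qed.

(* Mills' ratio bound: [s^2 phi(t)/t - (1 - Phi t)] decreases to 0. *)
Lemma mills_right (t : R) : 0 < t -> t * (1 - Phi t) <= s ^+ 2 * phi t.
Proof.
move=> t0; rewrite leNgt; apply/negP => tlt.
pose D x := s ^+ 2 * (x^-1 * phi x) - (1 - Phi x).
have dD (x : R) : 0 < x -> is_derive x 1 D (- (s ^+ 2 * phi x / x ^+ 2)).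
  move=> x0; have x_neq0 : x != 0 by rewrite gt_eqF.
  have dphi := is_derive_gauss_pdf x.
  have dPhi := is_derive_gauss_cdf x.
  have dV := @is_deriveV _ id x 1 1 x_neq0 (is_derive_id x 1).
  rewrite /D; apply: is_derive_eq; rewrite /GRing.scale/=.
  by field; rewrite s_neq0 x_neq0.
have Dt : D t < 0.
  rewrite /D subr_lt0 mulrCA ltr_pdivrMl// -mulrA; lra.
(* The limit of [D] is not computed. Dropping its nonnegative first term gives
   [D x >= - (1 - Phi x) > D t] at a far point [x], against the monotonicity of [D]. *)
have [x [tx xD]] : exists x, t <= x /\ 1 - Phi x < - D t.
  have /cvgrPdist_lt/(_ (- D t)) := gauss_cdf_cvgy.
  rewrite oppr_gt0 => /(_ Dt)[M [_ MP]].
  exists (Num.max t M + 1); split;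
    first by rewrite (@le_trans _ _ (Num.max t M)) ?lerDl// le_max lexx.
  apply: le_lt_trans (MP _ _); first exact: ler_norm.
  by rewrite (@le_lt_trans _ _ (Num.max t M)) ?ltrDl// le_max lexx orbT.
have [c /andP[tc cx] DE] := @mean_value _ D _ t x tx
  (fun z H => dD z (lt_le_trans t0 (proj1 (andP H)))).
have : D x <= D t.
  rewrite -subr_le0 DE mulNr oppr_le0 mulr_ge0 ?subr_ge0//.
  by apply: divr_ge0; first apply: mulr_ge0; rewrite ?sqr_ge0 ?normal_pdf_ge0.
suff : D t < D x by move=> /lt_le_trans H /H; rewrite ltxx.
have : 0 <= s ^+ 2 * (x^-1 * phi x).
  apply: mulr_ge0; first exact: sqr_ge0.
  apply: mulr_ge0; last exact: normal_pdf_ge0.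
  by rewrite invr_ge0 ltW// (lt_le_trans t0).
rewrite {2}/D; lra.
Qed.

(** The sum [Phi (- x) + Phi x] has derivative zero because the density is even; its limit at
    infinity identifies the constant as 1. *)
Lemma gauss_cdf_sym t : Phi (- t) = 1 - Phi t.
Proof.
have dD (x : R) : is_derive x 1 (fun x : R => Phi (- x) + Phi x) 0.
  have dPhi := is_derive_gauss_cdf x.
  have dPhiN := is_derive_gauss_cdf (- x).
  apply: is_derive_eq; rewrite /GRing.scale/= gauss_pdf_even.
  by ring.
have const (x : R) : Phi (- x) + Phi x = Phi (- t) + Phi t.
  have [c _] := mean_value_norm t x dD.
  by rewrite mul0r => /eqP; rewrite subr_eq0 => /eqP.
suff : Phi (- t) + Phi t = 1 by move=> <-; rewrite addrK.
have l1 : (Phi (- x) + Phi x) @[x --> +oo] --> (0 + 1 : R).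
  apply: cvgD gauss_cdf_cvgy.
  by have := gauss_cdf_cvgNy; rewrite cvgNy_compNP.
have l2 : (Phi (- x) + Phi x) @[x --> +oo] --> Phi (- t) + Phi t.
  by rewrite (_ : (fun x => _) = fun=> Phi (- t) + Phi t);
    [exact: cvg_cst|apply/funext => x; exact: const].
by rewrite add0r in l1; exact: (cvg_unique _ l2 l1).
Qed.

Lemma mills_left (t : R) : t < 0 -> - t * Phi t <= s ^+ 2 * phi t.
Proof.
rewrite -oppr_gt0 => /mills_right.
by rewrite gauss_cdf_sym gauss_pdf_even opprB addrC subrK.
Qed.

Definition gauss_tail (t : R) : R := Num.min (Phi t) (1 - Phi t).

(** For [|t| <= 1] the left side is at most 2 and [phi t >= phi 1], which gives the summand
    [2 / phi 1]. For [|t| > 1] Mills' bound gives [s ^+ 2 * phi t] for the tail times [|t|], hence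
    also for the tail itself, which gives [2 * s ^+ 2]. *)
Lemma gauss_tail_ratio :
  exists2 C, 0 < C & forall t, gauss_tail t * (1 + `|t|) <= C * phi t.
Proof.
have phi1 := gauss_pdf_gt0 1.
exists (2 * s ^+ 2 + 2 / phi 1).
  by apply: addr_gt0; [rewrite mulr_gt0 ?exprn_gt0|rewrite divr_gt0].
move=> t; have phit := gauss_pdf_gt0 t.
have T0 : 0 <= gauss_tail t by rewrite le_min gauss_cdf_ge0 subr_ge0
  gauss_cdf_le1.
have A : 0 <= 2 * s ^+ 2 * phi t by rewrite ?mulr_ge0 ?sqr_ge0// ltW.
have B : 0 <= 2 / phi 1 * phi t by rewrite ?mulr_ge0 ?invr_ge0// ltW.
rewrite mulrDl; have [t1|t1] := leP `|t| 1.
  suff : gauss_tail t * (1 + `|t|) <= 2 / phi 1 * phi t by lra.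
  apply: (@le_trans _ _ (1 * 2)).
    rewrite ler_pM//.
    + by rewrite ge_min gauss_cdf_le1.
    + by rewrite -[2]/(1 + 1) lerD2l.
  rewrite mul1r -mulrA ler_peMr// mulrC ler_pdivlMr// mul1r.
  rewrite normal_pdfE// ler_pM2l ?normal_peak_gt0// /normal_fun !subr0 ler_expR.
  rewrite ler_pM2r ?invr_gt0 ?mulrn_wgt0 ?exprn_gt0// lerN2.
  by rewrite expr1n -real_normK ?num_real// expr_le1.
suff : gauss_tail t * (1 + `|t|) <= 2 * s ^+ 2 * phi t by lra.
have : gauss_tail t * `|t| <= s ^+ 2 * phi t.
  have [t0|t0] := leP 0 t.
    rewrite ger0_norm// in t1 *.
    rewrite (le_trans _ (mills_right (lt_trans ltr01 t1)))// mulrC ler_wpM2l//.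
    by rewrite ge_min lexx orbT.
  rewrite (ltr0_norm t0).
  rewrite (le_trans _ (mills_left t0))// mulrC ler_wpM2l//;
    first by rewrite oppr_ge0 ltW.
  by rewrite ge_min lexx.
have : gauss_tail t <= gauss_tail t * `|t| by rewrite ler_peMr// ltW.
lra.
Qed.

(** * Regularity of the solution of Stein's equation *)

Section SteinFunction.
Variables (K k : R -> R) (L M : R).
Hypotheses (dK : forall u : R, is_derive u 1 K (k u))
  (kL : forall u v, `|k u - k v| <= L * `|u - v|)
  (kM : forall u, 0 <= u <= 1 -> `|k u| <= M)
  (K0 : K 0 = 0) (K1 : K 1 = 0).

(* k is the centred test function on [0, 1]; K0 and K1 say that its integral
   vanishes, and they make [stein] bounded by Mills' ratio. *)
Definition stein (x : R) : R := K (Phi x) / phi x.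
Definition stein' (x : R) : R := k (Phi x) + x / s ^+ 2 * stein x.

Lemma stein_eq x : s ^+ 2 * stein' x - x * stein x = s ^+ 2 * k (Phi x).
Proof. by rewrite /stein'; field. Qed.

Lemma is_derive_stein (x : R) : is_derive x 1 stein (stein' x).
Proof.
have dphi := is_derive_gauss_pdf x.
have dPhi := is_derive_gauss_cdf x.
have phi0 : phi x != 0 by rewrite gt_eqF// gauss_pdf_gt0.
have dV := @is_deriveV _ phi x _ 1 phi0 dphi.
have dKPhi : is_derive x 1 (fun x => K (Phi x)) (k (Phi x) * phi x).
  exact: (@is_derive1_comp _ K Phi).
rewrite /stein /stein'; apply: is_derive_eq; rewrite /GRing.scale/= /stein.
by field; rewrite s_neq0 phi0.
Qed.

Let M0 : 0 <= M.
Proof. by apply: le_trans (kM (u := 0) _); rewrite ?lexx ?ler01. Qed.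

Let L0 : 0 <= L.
Proof. by have := kL 1 0; rewrite subr0 normr1 mulr1; apply: le_trans. Qed.

(** The mean value theorem is applied from each endpoint, where [K] vanishes. At [u = Phi x] the
    minimum is [gauss_tail x], so [gauss_tail_ratio] makes the quotient [stein] bounded and even
    O(1/|x|). *)
Let KM u : 0 <= u <= 1 -> `|K u| <= M * Num.min u (1 - u).
Proof.
move=> /andP[u0 u1].
have [c /andP[c0 cu] E] := mean_value u0 (fun x _ => dK x).
have [e /andP[ue e1] F] := mean_value u1 (fun x _ => dK x).
rewrite K0 !subr0 in E; rewrite K1 sub0r in F.
case: (leP u (1 - u)) => _.
  by rewrite E normrM (ger0_norm u0) ler_wpM2r// kM// c0 (le_trans cu).
rewrite -normrN F normrM (@ger0_norm _ (1 - u)) ?subr_ge0// ler_wpM2r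
  ?subr_ge0//.
by rewrite kM// e1 andbT (le_trans u0).
Qed.

(** Since [k] is only Lipschitz, a Lipschitz bound on the derivative takes the place of a second
    derivative. Its linear growth is charged to the single point [v]: later [v] is a sum with one
    term left out, so [1 + |v|] splits off by independence. *)
Lemma stein_bounds : exists2 D, 0 <= D &
  (forall u v, `|stein' u - stein' v| <= D * (1 + `|v|) * `|u - v|) /\
  (forall v a, `|stein (v + a) - stein v - a * stein' v| <=
                 D * (1 + `|v|) * a ^+ 2).
Proof.
have [C C0 CP] := gauss_tail_ratio.
have fb x : `|stein x| * (1 + `|x|) <= M * C.
  have phix := gauss_pdf_gt0 x.
  rewrite /stein normrM normfV (gtr0_norm phix) mulrAC ler_pdivrMr//.
  rewrite -mulrA; apply: le_trans (ler_wpM2l M0 (CP x)).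
  rewrite mulrA ler_wpM2r// ?addr_ge0//.
  by rewrite KM// gauss_cdf_ge0 gauss_cdf_le1.
have fb0 x : `|stein x| <= M * C.
  by apply: le_trans (fb x); rewrite ler_peMr// lerDl.
have s2 : 0 < s ^+ 2 by rewrite exprn_gt0.
pose M1 := M + M * C / s ^+ 2.
have M1_0 : 0 <= M1.
  by rewrite addr_ge0// divr_ge0 ?mulr_ge0// ltW.
have dfb x : `|stein' x| <= M1.
  rewrite (le_trans (ler_normD _ _))// lerD//.
    by rewrite kM// gauss_cdf_ge0 gauss_cdf_le1.
  rewrite mulrAC normrM (gtr0_norm (x := _^-1)) ?invr_gt0//.
  rewrite ler_wpM2r//; first by rewrite invr_ge0 ltW.
  apply: le_trans (fb x); rewrite normrM mulrC ler_wpM2l// lerDr//.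
have fL u v : `|stein u - stein v| <= M1 * `|u - v|.
  have [c _ ->] := mean_value_norm v u is_derive_stein.
  by rewrite normrM ler_wpM2r.
have pk0 : 0 <= normal_peak s by exact: normal_peak_ge0.
pose D := L * normal_peak s + (M * C + M1) / s ^+ 2.
have D0 : 0 <= D.
  rewrite addr_ge0 ?mulr_ge0// ?addr_ge0 ?mulr_ge0// ?invr_ge0 1?ltW//.
have df2 u v : `|stein' u - stein' v| <= D * (1 + `|v|) * `|u - v|.
  (* The product [x * stein x] is split so that the possibly large factor [v] meets only a
     difference of [stein], which is Lipschitz, while the value [stein u] is bounded. *)
  have -> : stein' u - stein' v = (k (Phi u) - k (Phi v)) +
     ((u - v) * stein u + v * (stein u - stein v)) / s ^+ 2.
    by rewrite /stein'; ring.
  apply: (@le_trans _ _ (L * normal_peak s * `|u - v| +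
      (`|u - v| * (M * C) + `|v| * (M1 * `|u - v|)) / s ^+ 2)).
    rewrite (le_trans (ler_normD _ _))// lerD//.
      by rewrite (le_trans (kL _ _))// -mulrA ler_wpM2l// gauss_cdf_lipschitz.
    rewrite normrM (gtr0_norm (x := _^-1)) ?invr_gt0//.
    rewrite ler_wpM2r//; first by rewrite invr_ge0 ltW.
    rewrite (le_trans (ler_normD _ _))//.
    by rewrite lerD// normrM ler_wpM2l.
  rewrite -subr_ge0.
  have -> : D * (1 + `|v|) * `|u - v| - (L * normal_peak s * `|u - v| +
      (`|u - v| * (M * C) + `|v| * (M1 * `|u - v|)) / s ^+ 2) =
    `|u - v| * (L * normal_peak s * `|v| + (M1 + `|v| * (M * C)) / s ^+ 2).
    by rewrite /D; ring.
  by rewrite ?(mulr_ge0, addr_ge0)// ?invr_ge0 ltW.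
exists D => //; split=> // v a.
have [c] := mean_value_norm v (v + a) is_derive_stein.
rewrite (addrC v) addrK => ca ->.
have -> : stein' c * a - a * stein' v = a * (stein' c - stein' v) by ring.
rewrite normrM -real_normK ?num_real// expr2 mulrCA ler_wpM2l//.
apply: le_trans (df2 _ _) _; rewrite ler_wpM2l// mulr_ge0// addr_ge0//.
Qed.

End SteinFunction.
End Gaussian.

(** * The central limit theorem *)

Section SteinCLT.
Variables (R : realType) (A I : finType) (w : A -> R).
Hypotheses (w_ge0 : forall z, 0 <= w z) (w_sum1 : \sum_z w z = 1).
Variables (xi : A -> R) (v s : R).
Hypotheses (v_gt0 : 0 < v) (s2E : #|I|%:R * v = s ^+ 2).
Hypotheses (xi1 : mean w xi = 0) (xi2 : mean w (fun z => xi z ^+ 2) = v)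
  (xi4 : mean w (fun z => xi z ^+ 4) <= 3 * v ^+ 2).

Local Notation E := (@prod_mean R A I w).

Definition coord_sum (X : {ffun I -> A}) : R := \sum_i xi (X i).
Definition coord_sum_but (i : I) (X : {ffun I -> A}) : R :=
  \sum_(j | j != i) xi (X j).
Local Notation W := coord_sum.

Lemma coord_sumD1 i X : W X = coord_sum_but i X + xi (X i).
Proof. by rewrite /W (bigD1 i)//= addrC. Qed.

Lemma coord_sum_but_resample i X z :
  coord_sum_but i (resample X i z) = coord_sum_but i X.
Proof. by apply: eq_bigr => j ji; rewrite resample_other. Qed.

Lemma coord_orthogonal i j : i != j -> E (fun X => xi (X i) * xi (X j)) = 0.
Proof.
move=> ij; rewrite (prod_mean_indep w_sum1 xi (h := fun X => xi (X j)))//.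
  by rewrite xi1 mul0r.
by move=> X z; rewrite resample_other// eq_sym.
Qed.

(** The inequality a <= t/2 + a^2/(2t) at t = sqrt v stands in for Cauchy-Schwarz. *)
Lemma mean_abs : mean w (fun z => `|xi z|) <= Num.sqrt v.
Proof.
have rv : 0 < Num.sqrt v by rewrite sqrtr_gt0.
have rv2 : Num.sqrt v ^+ 2 = v by rewrite sqr_sqrtr// ltW.
apply: (@le_trans _ _ (mean w (fun z => Num.sqrt v / 2 + (2 * Num.sqrt v)^-1 *
  xi z ^+ 2))).
  apply: ler_mean => // z; rewrite -[xi z ^+ 2]real_normK ?num_real//.
  set a := `|_|; set t := Num.sqrt v in rv *.
  have -> : t / 2 + (2 * t)^-1 * a ^+ 2 = a + (t - a) ^+ 2 / (2 * t).
    by field; rewrite gt_eqF.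
  by rewrite lerDl divr_ge0 ?sqr_ge0// mulr_ge0// ltW.
rewrite meanD mean_cst// meanZ xi2.
have -> : (2 * Num.sqrt v)^-1 * v = Num.sqrt v / 2.
  by rewrite -{2}rv2; field; rewrite gt_eqF.
lra.
Qed.

(** The inequality behind [mean_abs], multiplied by the square of [xi]: the second moment
    contributes 1/2 and the fourth 3/2, in units of [v * Num.sqrt v]. *)
Lemma mean_abs3 : mean w (fun z => `|xi z| * xi z ^+ 2) <= 2 * v * Num.sqrt v.
Proof.
have rv : 0 < Num.sqrt v by rewrite sqrtr_gt0.
have rv2 : Num.sqrt v ^+ 2 = v by rewrite sqr_sqrtr// ltW.
apply: (@le_trans _ _ (mean w (fun z => Num.sqrt v / 2 * xi z ^+ 2 +
   (2 * Num.sqrt v)^-1 * xi z ^+ 4))).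
  apply: ler_mean => // z.
  rewrite (_ : 4%N = (2 * 2)%N)// exprM -[xi z ^+ 2]real_normK ?num_real//.
  set a := `|_|; set t := Num.sqrt v in rv *.
  have -> : t / 2 * a ^+ 2 + (2 * t)^-1 * (a ^+ 2) ^+ 2 =
     a * a ^+ 2 + a ^+ 2 * (t - a) ^+ 2 / (2 * t).
    by field; rewrite gt_eqF.
  rewrite lerDl; apply: divr_ge0; first by rewrite mulr_ge0 ?sqr_ge0.
  by rewrite mulr_ge0// ltW.
rewrite meanD !meanZ xi2.
apply: (@le_trans _ _ (Num.sqrt v / 2 * v + (2 * Num.sqrt v)^-1 * (3 * v ^+
  2))).
  by rewrite lerD2l ler_wpM2l// invr_ge0 mulr_ge0// ltW.
have -> : (2 * Num.sqrt v)^-1 * (3 * v ^+ 2) = 3 / 2 * (Num.sqrt v * v).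
  by rewrite expr2 -{2}rv2; field; rewrite gt_eqF.
lra.
Qed.

Lemma mean_sqr_coord_sum_but i :
  E (fun X => coord_sum_but i X ^+ 2) <= s ^+ 2.
Proof.
rewrite prod_mean_sqr_sum//; last by move=> *; exact: coord_orthogonal.
rewrite -s2E; under eq_bigr => j _.
  by rewrite (prod_mean_coord w_sum1 j (fun z => xi z ^+ 2)) xi2; over.
rewrite sumr_const -[_ *+ _]mulr_natl.
rewrite ler_wpM2r//; first exact: ltW.
by rewrite ler_nat max_card.
Qed.

Lemma mean_coord_sum_but i :
  E (fun X => 1 + `|coord_sum_but i X|) <= 2 + s ^+ 2.
Proof.
apply: (@le_trans _ _ (E (fun X => 2 + coord_sum_but i X ^+ 2))).
  apply: ler_prod_mean => // X;
    rewrite -(real_normK (num_real (coord_sum_but i X))).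
  set a := `|_|; have : 0 <= (a - 1 / 2) ^+ 2 by exact: sqr_ge0.
  by nra.
by rewrite prod_meanD prod_mean_cst// lerD2l mean_sqr_coord_sum_but.
Qed.

(** Leave one out: [s ^+ 2] is split into one [v] per index, and for each [i] both terms are
    compared with [v * f' (Wi i X)]. Each index costs a multiple of [v * Num.sqrt v], and the
    factors [v] add up to [s ^+ 2], so only [Num.sqrt v] remains small. *)
Lemma stein_estimate (f f' : R -> R) (D : R) : 0 <= D ->
  (forall u z, `|f' u - f' z| <= D * (1 + `|z|) * `|u - z|) ->
  (forall z a, `|f (z + a) - f z - a * f' z| <= D * (1 + `|z|) * a ^+ 2) ->
  `|E (fun X => s ^+ 2 * f' (W X) - W X * f (W X))| <=
    3 * D * (2 + s ^+ 2) * s ^+ 2 * Num.sqrt v.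
Proof.
move=> D0 f'D fD.
have rv : 0 < Num.sqrt v by rewrite sqrtr_gt0.
pose Wi := coord_sum_but; have s20 : 0 <= s ^+ 2 := sqr_ge0 s.
have Wir := coord_sum_but_resample.
have T1 i : `|E (fun X => v * f' (W X) - v * f' (Wi i X))| <=
    D * (2 + s ^+ 2) * v * Num.sqrt v.
  apply: le_trans (ler_norm_prod_mean w_ge0 _) _.
  apply: (@le_trans _ _ (E (fun X => v * D * (`|xi (X i)| * (1 + `|Wi i X|))))).
    apply: ler_prod_mean => // X; rewrite -mulrBr normrM (gtr0_norm v_gt0).
    rewrite -mulrA ler_wpM2l//; first exact: ltW.
    apply: le_trans (f'D _ _) _; rewrite (coord_sumD1 i) addrAC subrr add0r.
    by rewrite le_eqVlt; apply/orP; left; apply/eqP; ring.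
  rewrite prod_meanZ (prod_mean_indep w_sum1 (fun z => `|xi z|)
    (h := fun X => 1 + `|Wi i X|)); last by move=> X z; rewrite /Wi Wir.
  rewrite (_ : D * _ * _ * _ = v * D * (Num.sqrt v * (2 + s ^+ 2)));
    last by ring.
  rewrite ler_wpM2l//; first by rewrite mulr_ge0// ltW.
  rewrite ler_pM ?mean_abs ?mean_coord_sum_but//.
    by apply: sumr_ge0 => z _; rewrite mulr_ge0.
  by apply: sumr_ge0 => z _; rewrite mulr_ge0 ?prod_weight_ge0// addr_ge0.
have T2 i : `|E (fun X => v * f' (Wi i X) - xi (X i) * f (W X))| <=
    2 * (D * (2 + s ^+ 2) * v * Num.sqrt v).
  (* As [xi (X i)] is independent of [Wi i X], the zeroth-order Taylor term has mean 0 and the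
     first-order one has mean [v] times that of [f' (Wi i X)]; the whole difference is a Taylor
     remainder. *)
  have -> : E (fun X => v * f' (Wi i X) - xi (X i) * f (W X)) =
      - E (fun X => xi (X i) * (f (Wi i X + xi (X i)) - f (Wi i X) - xi (X i)
        * f' (Wi i X))).
    transitivity (- (E (fun X => xi (X i) * f (W X)) -
       E (fun X => xi (X i) * f (Wi i X)) - E (fun X => xi (X i) ^+ 2 * f' (Wi
         i X)))).
      rewrite (prod_mean_indep w_sum1 xi (h := fun X => f (Wi i X)));
        last first.
        by move=> X z; rewrite /Wi Wir.
      rewrite (prod_mean_indep w_sum1 (fun z => xi z ^+ 2) (h := fun X => f'
        (Wi i X))); last first.
        by move=> X z; rewrite /Wi Wir.
      by rewrite xi1 xi2 prod_meanB prod_meanZ; ring.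
    rewrite -!prod_meanB; congr (- _); apply: eq_prod_mean => X.
    by rewrite (coord_sumD1 i) -/(Wi i X); ring.
  rewrite normrN; apply: le_trans (ler_norm_prod_mean w_ge0 _) _.
  apply: (@le_trans _ _ (E (fun X => D * ((`|xi (X i)| * xi (X i) ^+ 2) * (1 +
    `|Wi i X|))))).
    apply: ler_prod_mean => // X; rewrite normrM.
    rewrite (_ : D * _ = `|xi (X i)| * (D * (1 + `|Wi i X|) * xi (X i) ^+ 2));
      last by ring.
    by rewrite ler_wpM2l.
  rewrite prod_meanZ (prod_mean_indep w_sum1 (fun z => `|xi z| * xi z ^+ 2)
    (h := fun X => 1 + `|Wi i X|)); last by move=> X z; rewrite /Wi Wir.
  rewrite (_ : 2 * _ = D * (2 * v * Num.sqrt v * (2 + s ^+ 2))); last by ring.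
  rewrite ler_wpM2l//.
  rewrite ler_pM ?mean_abs3 ?mean_coord_sum_but//.
    by apply: sumr_ge0 => z _; rewrite mulr_ge0// mulr_ge0// sqr_ge0.
  by apply: sumr_ge0 => z _; rewrite mulr_ge0 ?prod_weight_ge0// addr_ge0.
have -> : E (fun X => s ^+ 2 * f' (W X) - W X * f (W X)) =
   \sum_i (E (fun X => v * f' (W X) - v * f' (Wi i X)) +
           E (fun X => v * f' (Wi i X) - xi (X i) * f (W X))).
  under [RHS]eq_bigr do rewrite -prod_meanD.
  rewrite -prod_mean_sum; apply: eq_prod_mean => X.
  under [RHS]eq_bigr do rewrite addrA subrK.
  rewrite big_split/= sumrN -!big_distrl/= -/(W X) -s2E.
  by rewrite sumr_const -[v *+ _]mulr_natl.
apply: le_trans (ler_norm_sum _ _ _) _.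
apply: (@le_trans _ _ (\sum_(i : I) 3 * (D * (2 + s ^+ 2) * v * Num.sqrt v))).
  apply: ler_sum => i _; apply: le_trans (ler_normD _ _) _.
  by have := T1 i; have := T2 i; lra.
rewrite sumr_const -mulr_natl -s2E.
by rewrite le_eqVlt; apply/orP; left; apply/eqP; ring.
Qed.

End SteinCLT.

(** Made for the squared positive part, which is differentiable across its break point although it
    is defined by cases. *)
Lemma is_derive_quadratic_error (R : realType) (f : R -> R) (x d : R) :
  (forall h, `|f (x + h) - f x - h * d| <= h ^+ 2) -> is_derive x 1 f d.
Proof.
move=> fd.
have q : h^-1 *: (f (h *: 1 + x) - f x) @[h --> 0^'] --> d.
  apply/cvgrPdist_le => e e0; near=> h.
  have h0 : h != 0 by near: h; exact: nbhs_dnbhs_neq.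
  have he : `|h| <= e.
    by near: h; exact: dnbhs0_le.
  apply: le_trans he; rewrite -(ler_pM2l (x := `|h|)) ?normr_gt0// -expr2.
  rewrite -normrM real_normK ?num_real//.
  apply: le_trans (fd h); rewrite -normrN /GRing.scale/= mulr1 (addrC h).
  by rewrite mulrBr opprB mulrA divff// mul1r.
by apply: DeriveDef; [apply/cvg_ex; exists d|exact: cvg_lim q].
Unshelve. all: by end_near. Qed.

(** * Piecewise linear test functions on [0, 1] *)

Section Ramp.
Variable R : realType.
Implicit Types u del v : R.

Let pos (t : R) : R := Num.max 0 t.
Let pos2 (t : R) : R := Num.max 0 t ^+ 2 / 2.

Let posL (u v : R) : `|pos u - pos v| <= `|u - v|.
Proof.
rewrite /pos; case: (leP 0 u) => u_; case: (leP 0 v) => v_;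
  rewrite ?subr0 ?subrr ?sub0r ?normr0//.
- by rewrite ger0_norm// (le_trans _ (ler_norm _))//; lra.
- by rewrite normrN distrC ger0_norm// (le_trans _ (ler_norm _))//; lra.
Qed.

Let dpos2 (u : R) : is_derive u 1 pos2 (pos u).
Proof.
apply: is_derive_quadratic_error => h; rewrite /pos2 /pos ler_norml.
by case: (leP 0 u) => u_; case: (leP 0 (u + h)) => v_; apply/andP; split; nra.
Qed.

(** The function is 1 up to [u0], 0 from [u0 + del] on, and linear in between. As a difference of
    positive parts it inherits its Lipschitz bound and primitive from theirs. *)
Definition ramp u0 del (u : R) : R :=
  (Num.max 0 (u0 + del - u) - Num.max 0 (u0 - u)) / del.
Definition ramp_mean u0 del : R := u0 + del / 2.
(** A primitive of [ramp] minus its integral over [0, 1]. The term in [1 - u] normalises it to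
    vanish at 1; it then vanishes at 0 exactly because [ramp_mean] is that integral, provided the
    ramp fits into [0, 1]. *)
Definition ramp_prim u0 del (u : R) : R :=
  - (pos2 (u0 + del - u) - pos2 (u0 - u)) / del + ramp_mean u0 del * (1 - u).

Lemma ramp_ge0 u0 del u : 0 < del -> 0 <= ramp u0 del u.
Proof.
move=> del_gt0.
rewrite /ramp divr_ge0 ?(ltW del_gt0)// subr_ge0.
case: (leP 0 (u0 - u)) => _; rewrite le_max ?lexx//.
rewrite lerD2r lerDl. by rewrite (ltW del_gt0) orbT.
Qed.

Lemma ramp_le1 u0 del u : 0 < del -> ramp u0 del u <= 1.
Proof.
move=> del_gt0.
rewrite /ramp ler_pdivrMr// mul1r.
by case: (leP 0 (u0 + del - u)) => ?; case: (leP 0 (u0 - u)) => ?; lra.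
Qed.

Lemma ramp_left u0 del u : 0 < del -> u <= u0 -> ramp u0 del u = 1.
Proof.
move=> del_gt0 uu; rewrite /ramp !max_r; [by field; rewrite gt_eqF|lra|lra].
Qed.

Lemma ramp_right u0 del u : 0 < del -> u0 + del <= u -> ramp u0 del u = 0.
Proof.
move=> del_gt0 uu; rewrite /ramp !max_l; [by rewrite subrr mul0r|lra|lra].
Qed.

Lemma is_derive_ramp_prim u0 del (u : R) : 0 < del ->
  is_derive u 1 (ramp_prim u0 del) (ramp u0 del u - ramp_mean u0 del).
Proof.
move=> del_gt0.
have d1 : is_derive u 1 (fun u => pos2 (u0 + del - u)) (- pos (u0 + del - u)).
  have := @is_derive1_comp R pos2 (fun u => u0 + del - u) u _ (-1) (dpos2 _).
  by rewrite mulrN1; apply; apply: is_derive_eq; ring.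
have d2 : is_derive u 1 (fun u => pos2 (u0 - u)) (- pos (u0 - u)).
  have := @is_derive1_comp R pos2 (fun u => u0 - u) u _ (-1) (dpos2 _).
  by rewrite mulrN1; apply; apply: is_derive_eq; ring.
rewrite /ramp_prim; apply: is_derive_eq;
  rewrite /GRing.scale/= /ramp -/(pos _) -/(pos _).
by field; rewrite gt_eqF.
Qed.

Lemma ramp_prim0 u0 del : 0 <= u0 -> 0 < del -> ramp_prim u0 del 0 = 0.
Proof.
move=> u0_ge0 del_gt0.
rewrite /ramp_prim /pos2 !subr0 !max_r//; last by rewrite addr_ge0// ltW.
by rewrite /ramp_mean; field; rewrite gt_eqF.
Qed.

Lemma ramp_prim1 u0 del : 0 < del -> u0 + del <= 1 -> ramp_prim u0 del 1 = 0.
Proof.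
move=> del_gt0 u0del.
rewrite /ramp_prim /pos2 !max_l; [by rewrite /ramp_mean; field;
  rewrite gt_eqF|lra|lra].
Qed.

Lemma ramp_lipschitz u0 del u v : 0 < del ->
  `|(ramp u0 del u - ramp_mean u0 del) - (ramp u0 del v - ramp_mean u0 del)| <=
    2 / del * `|u - v|.
Proof.
move=> del_gt0; have -> :
  (ramp u0 del u - ramp_mean u0 del) - (ramp u0 del v - ramp_mean u0 del) =
  ((pos (u0 + del - u) - pos (u0 + del - v)) - (pos (u0 - u) - pos (u0 - v)))
    / del.
  by rewrite /ramp /pos; field; rewrite gt_eqF.
rewrite normrM (gtr0_norm (x := _^-1)) ?invr_gt0// mulrAC ler_wpM2r//.
  by rewrite invr_ge0 ltW.
apply: le_trans (ler_normB _ _) _.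
have := posL (u0 + del - u) (u0 + del - v).
have := posL (u0 - u) (u0 - v).
have -> : u0 - u - (u0 - v) = - (u - v) by ring.
have -> : u0 + del - u - (u0 + del - v) = - (u - v) by ring.
rewrite normrN; lra.
Qed.

Lemma ramp_bounded u0 del u : 0 <= u0 -> 0 < del -> u0 + del <= 1 ->
  `|ramp u0 del u - ramp_mean u0 del| <= 1.
Proof.
move=> u0_ge0 del_gt0 u0del.
have := ramp_ge0 u0 u del_gt0; have := ramp_le1 u0 u del_gt0.
have : 0 <= ramp_mean u0 del by rewrite /ramp_mean addr_ge0// divr_ge0// ltW.
have : ramp_mean u0 del <= 1 by rewrite /ramp_mean; lra.
by rewrite ler_norml => *; apply/andP; split; lra.
Qed.

End Ramp.

(** Bundling the hypotheses lets the error constants below be chosen before the alphabet, the index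
    set and the law, all of which change with n while [s] stays fixed. *)
Definition clt_data (R : realType) (A I : finType) (w xi : A -> R) (v s : R) :=
  [/\ (forall z, 0 <= w z), \sum_z w z = 1, 0 < v &
   [/\ #|I|%:R * v = s ^+ 2, mean w xi = 0, mean w (fun z => xi z ^+ 2) = v
    & mean w (fun z => xi z ^+ 4) <= 3 * v ^+ 2]].

(** * From smooth test functions to distribution functions *)

Section CLT.
Variables (R : realType) (s : R).
Hypothesis s_gt0 : 0 < s.
Local Notation Phi := (gauss_cdf s).

Lemma clt_ramp (u0 del : R) : 0 <= u0 -> 0 < del -> u0 + del <= 1 ->
  exists2 D, 0 <= D & forall (A I : finType) (w xi : A -> R) (v : R),
    clt_data I w xi v s ->
    `|prod_mean w (fun X : {ffun I -> A} => ramp u0 del (Phi (coord_sum xi X)))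
      - (u0 + del / 2)| <= D * Num.sqrt v.
Proof.
move=> u00 del0 u0del.
have [D D0 [b1 b2]] := stein_bounds s_gt0 (fun u => is_derive_ramp_prim u0 u
  del0)
  (fun u z => ramp_lipschitz u0 u z del0)
  (fun u _ => ramp_bounded u u00 del0 u0del)
  (ramp_prim0 u00 del0) (ramp_prim1 del0 u0del).
exists (3 * D * (2 + s ^+ 2)); first by rewrite !mulr_ge0// addr_ge0// sqr_ge0.
move=> A I w xi v [w0 w1 v0 [s2 m1 m2 m4]].
have s20 : 0 < s ^+ 2 by rewrite exprn_gt0.
have := stein_estimate w0 w1 v0 s2 m1 m2 m4 D0 b1 b2.
under eq_prod_mean do rewrite stein_eq//.
rewrite prod_meanZ prod_meanB prod_mean_cst// normrM (gtr0_norm s20).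
by rewrite (mulrAC _ (s ^+ 2)) (mulrC (s ^+ 2)) ler_pM2r.
Qed.

(** The indicator of [W <= x] lies below the ramp from [Phi x] to [Phi x + e] and above the one from
    [Phi x - e] to [Phi x], both evaluated at [Phi W]. Their means differ from [Phi x] by only
    [e / 2]. *)
Lemma clt_cdf (x e : R) : 0 < e ->
  exists2 D, 0 <= D & forall (A I : finType) (w xi : A -> R) (v : R),
    clt_data I w xi v s ->
    `|prod_mean w (fun X : {ffun I -> A} => (coord_sum xi X <= x)%R%:R)
      - Phi x| <= e + D * Num.sqrt v.
Proof.
move=> e0.
have P0 := gauss_cdf_ge0 s x; have P1 := gauss_cdf_le1 s x.
have [D1 D1_ge0 H1] : exists2 D, 0 <= D & forall (A I : finType) (w xi : A ->
  R) (v : R),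
    clt_data I w xi v s ->
    prod_mean w (fun X : {ffun I -> A} => (coord_sum xi X <= x)%R%:R)
      <= Phi x + e + D * Num.sqrt v.
  have [le1|gt1] := leP (Phi x + e) 1.
    have [D D0 DP] := clt_ramp P0 e0 le1.
    exists D => // A I w xi v cd; have [w0 w1 _ _] := cd.
    have := DP _ _ _ _ _ cd; rewrite ler_norml => /andP[_].
    set L := prod_mean _ _; set L' := prod_mean _ _ => H.
    suff : L' <= L by lra.
    apply: ler_prod_mean => // X; have [Xx|_] := leP (coord_sum xi X) x;
      last exact: ramp_ge0.
    by rewrite ramp_left//; exact: gauss_cdf_nd.
  (* Here [Phi x + e] exceeds 1 and the ramp does not fit into [0, 1], but the bound is trivial
     since a probability is at most 1. The lower bound has the same degenerate case. *)
  exists 0 => // A I w xi v [w0 w1 _ _].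
  apply: (@le_trans _ _ 1); last by rewrite mul0r addr0 ltW.
  by rewrite -[leRHS](prod_mean_cst I w1); apply: ler_prod_mean => // X;
    rewrite lern1 leq_b1.
have [D2 D2_ge0 H2] : exists2 D, 0 <= D & forall (A I : finType) (w xi : A ->
  R) (v : R),
    clt_data I w xi v s ->
    Phi x - e - D * Num.sqrt v <=
    prod_mean w (fun X : {ffun I -> A} => (coord_sum xi X <= x)%R%:R).
  have [ge0|lt0] := leP 0 (Phi x - e).
    have le1 : Phi x - e + e <= 1 by rewrite subrK.
    have [D D0 DP] := clt_ramp ge0 e0 le1.
    exists D => // A I w xi v cd; have [w0 w1 _ _] := cd.
    have := DP _ _ _ _ _ cd; rewrite ler_norml => /andP[+ _].
    set L := prod_mean _ _; set L' := prod_mean _ _ => H.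
    suff : L <= L' by lra.
    apply: ler_prod_mean => // X; have [_|Xx] := leP (coord_sum xi X) x;
      first exact: ramp_le1.
    by rewrite ramp_right// subrK gauss_cdf_nd// ltW.
  exists 0 => // A I w xi v [w0 w1 _ _].
  rewrite mul0r subr0 (le_trans (ltW lt0))//.
  by rewrite -[leLHS](prod_mean_cst I w1); apply: ler_prod_mean.
exists (D1 + D2); first exact: addr_ge0.
move=> A I w xi v cd; have := H1 _ _ _ _ _ cd; have := H2 _ _ _ _ _ cd.
have := sqrtr_ge0 v; rewrite ler_norml => r0 h1 h2; apply/andP; split; nra.
Qed.

End CLT.

(** * Top eigenvalue of a rank-one perturbation *)

Section QuadraticForm.
Variables (R : realType).

Definition quad p (M : 'I_p -> 'I_p -> R) (x : 'I_p -> R) : R :=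
  \sum_i \sum_j x i * M i j * x j.

Lemma quadZ p (M : 'I_p -> 'I_p -> R) (c : R) x :
  quad M (fun i => c * x i) = c ^+ 2 * quad M x.
Proof.
rewrite /quad big_distrr/=; apply: eq_bigr => i _.
by rewrite big_distrr/=; apply: eq_bigr => j _; ring.
Qed.

Lemma quad_shift p (M : 'I_p -> 'I_p -> R) (c : R) (x : 'I_p -> R) :
  (forall i j, M i j = M j i) ->
  quad M (fun i => c + x i) =
  c ^+ 2 * (\sum_i \sum_j M i j) + 2 * c * (\sum_i (\sum_j M i j) * x i) +
    quad M x.
Proof.
move=> Msym.
transitivity (\sum_i \sum_j (c ^+ 2 * M i j + c * (M i j * x i)) +
   \sum_i \sum_j c * (M i j * x j) + quad M x).
  rewrite -!big_split/=; apply: eq_bigr => i _; rewrite -!big_split/=.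
  by apply: eq_bigr => j _; ring.
congr (_ + _).
have -> : \sum_i \sum_j c * (M i j * x j) = c * (\sum_i (\sum_j M i j) * x i).
  rewrite exchange_big big_distrr/=; apply: eq_bigr => i _.
  rewrite big_distrl big_distrr/=; apply: eq_bigr => j _.
  by rewrite (Msym j).
under eq_bigr => i _ do rewrite big_split/= -!big_distrr -big_distrl/=.
by rewrite big_split/= -!big_distrr/=; ring.
Qed.

(** The operator norm is at most the Frobenius norm. Termwise AM-GM replaces Cauchy-Schwarz, with
    weights balanced so that the two halves each contribute half of f times the squared length. *)
Lemma quad_frobenius p (M : 'I_p -> 'I_p -> R) (f : R) (x : 'I_p -> R) : 0 < f
  ->
  \sum_i \sum_j M i j ^+ 2 <= f ^+ 2 -> quad M x <= f * (\sum_i x i ^+ 2).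
Proof.
move=> f0 Mf; move Ndef : (\sum_i x i ^+ 2) => N.
have N0 : 0 <= N by rewrite -Ndef; apply: sumr_ge0 => i _; exact: sqr_ge0.
have [N_0|N_gt0] := eqVneq N 0.
  have x0 i : x i = 0.
    have /psumr_eq0P : \sum_i x i ^+ 2 = 0 by rewrite Ndef.
    move=> /(_ (fun i _ => sqr_ge0 _))/(_ i isT)/eqP.
    by rewrite sqrf_eq0 => /eqP.
  rewrite N_0 mulr0 /quad big1// => i _; rewrite big1// => j _.
  by rewrite x0 !mul0r.
have {}N_gt0 : 0 < N by rewrite lt_def N_gt0.
have : quad M x <= N / (2 * f) * (\sum_i \sum_j M i j ^+ 2) +
    f / (2 * N) * (\sum_i \sum_j x i ^+ 2 * x j ^+ 2).
  rewrite !big_distrr/= -big_split/=; apply: ler_sum => i _.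
  rewrite !big_distrr/= -big_split/=; apply: ler_sum => j _.
  rewrite -subr_ge0.
  have -> : N / (2 * f) * M i j ^+ 2 + f / (2 * N) * (x i ^+ 2 * x j ^+ 2) -
    x i * M i j * x j = (N * M i j - f * (x i * x j)) ^+ 2 / (2 * f * N).
    by field; rewrite !gt_eqF.
  by rewrite divr_ge0 ?sqr_ge0// !mulr_ge0// ltW.
move=> /le_trans; apply.
have -> : \sum_i \sum_j x i ^+ 2 * x j ^+ 2 = N * N.
  by rewrite -Ndef big_distrl/=; apply: eq_bigr => i _; rewrite big_distrr.
apply: (@le_trans _ _ (N / (2 * f) * f ^+ 2 + f / (2 * N) * (N * N))).
  by rewrite lerD2r ler_wpM2l// divr_ge0// ?mulr_ge0// ltW.
rewrite le_eqVlt; apply/orP; left; apply/eqP; field.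
by rewrite !gt_eqF.
Qed.

Lemma sum_mul_le n (u v : 'I_n -> R) (t : R) : 0 < t ->
  2 * (\sum_i u i * v i) <= t * (\sum_i u i ^+ 2) + t^-1 * (\sum_i v i ^+ 2).
Proof.
move=> t0; rewrite !big_distrr/= -big_split/=; apply: ler_sum => i _.
rewrite -subr_ge0.
have -> : t * u i ^+ 2 + t^-1 * v i ^+ 2 - 2 * (u i * v i) =
  (t * u i - v i) ^+ 2 / t by field; rewrite gt_eqF.
by rewrite divr_ge0 ?sqr_ge0// ltW.
Qed.

End QuadraticForm.

(** * Deterministic expansion of the top eigenvalue *)

Section TopEigenvalue.
Variables (R : realType).

(** No randomness is left here: [lambda] is known through its two variational properties, [H] stands
    for G - I, and every fluctuation is measured in units of [eta]. The factor 20 is slack; the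
    lower bound spends 15 [eta]. *)
Lemma top_eigenvalue_expansion p (a : 'I_p -> R) (H : 'I_p -> 'I_p -> R)
    (lambda y e : R) :
  let M i j := 1 - a i - a j + (i == j)%:R + H i j in
  let h i := \sum_j H i j in
  let S := \sum_i a i in
  let eta := e / 20 in
  0 < y -> y < 1 -> 0 < e -> e <= 1 -> 2 <= eta * p%:R ->
  (forall i j, H i j = H j i) ->
  (forall x, 0 <= (\sum_i x i ^+ 2) + quad H x) ->
  (forall x, quad M x <= lambda * (\sum_i x i ^+ 2)) ->
  (forall b, (forall x, quad M x <= b * (\sum_i x i ^+ 2)) -> lambda <= b) ->
  `|\sum_i a i ^+ 2 - y| <= eta ->
  \sum_i h i ^+ 2 <= (eta * p%:R) ^+ 2 ->
  \sum_i \sum_j H i j ^+ 2 <= (eta * p%:R) ^+ 2 ->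
  `|\sum_i h i| <= eta * p%:R ->
  S ^+ 2 <= eta ^+ 2 * p%:R ->
  `|lambda - (p%:R + 1 + y) + 2 * S| <= e.
Proof.
move=> M h S eta y0 y1 e0 e1 pbig Hsym Gpsd lam_ge lam_le.
rewrite ler_norml => /andP[Qlo Qhi] hh F;
  rewrite ler_norml => /andP[Ulo Uhi] S2.
set Q := \sum_i a i ^+ 2 in Qlo Qhi.
set U := \sum_i h i in Ulo Uhi.
set P := p%:R in pbig hh F Ulo Uhi S2 *.
have eta0 : 0 < eta by rewrite divr_gt0.
have eta20 : e = 20 * eta by rewrite /eta; field.
clearbody eta.
have P0 : 0 < P by rewrite -(pmulr_rgt0 _ eta0); apply: lt_le_trans pbig.
have P_neq0 : P != 0 by rewrite gt_eqF.
(* This constant centres [z]: it is minus the average of [- a i + h i / P]. *)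
pose k := (S - U / P) / P.
pose z i := - a i + h i / P + k.
pose Z := \sum_i z i ^+ 2.
have sum_cst (c : R) : \sum_(i < p) c = P * c.
  by rewrite sumr_const card_ord mulr_natl.
have sz : \sum_i z i = 0.
  by rewrite /z !big_split/= sumrN -big_distrl/= sum_cst -/S -/U /k; field.
have quadME x : quad M x = (\sum_i x i) ^+ 2 - 2 * (\sum_i a i * x i) *
  (\sum_i x i)
    + \sum_i x i ^+ 2 + quad H x.
  have -> : quad M x = \sum_i (x i * (\sum_j x j) - a i * x i * (\sum_j x j) -
     x i * (\sum_j a j * x j) + x i ^+ 2 + \sum_j x i * H i j * x j).
    apply: eq_bigr => i _.
    have delta : \sum_j (i == j)%:R * x j = x i.
      rewrite (bigD1 i)//= eqxx mul1r big1 ?addr0// => j; rewrite eq_sym.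
      by move=> /negbTE ->; rewrite mul0r.
    transitivity (\sum_j (x i * x j + (- (a i * x i)) * x j + (- x i) * (a j *
      x j)
        + x i * ((i == j)%:R * x j) + x i * H i j * x j)).
      by apply: eq_bigr => j _; rewrite /M; ring.
    rewrite !big_split/= -!big_distrr/= delta.
    by ring.
  rewrite !big_split/= !sumrN -!big_distrl/= -/(quad _ _).
  by ring.
(* On vectors of sum zero the parts 1 and [a i + a j] of [M] vanish, so only I + H survives there;
   the coupling with the constant direction is [P * z]. *)
have quadMs c x : \sum_i x i = 0 -> quad M (fun i => c + x i) =
   c ^+ 2 * (P ^+ 2 - 2 * P * S + P + U) + 2 * c * P * (\sum_i z i * x i) +
   \sum_i x i ^+ 2 + quad H x.
  move=> sx; rewrite quadME quad_shift// -/U.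
  have -> : \sum_i (c + x i) = P * c by rewrite big_split/= sx addr0 sum_cst.
  have -> : \sum_i a i * (c + x i) = c * S + \sum_i a i * x i.
    transitivity (\sum_i (c * a i + a i * x i)).
      by apply: eq_bigr => i _; ring.
    by rewrite big_split/= -big_distrr.
  have -> : \sum_i (c + x i) ^+ 2 = P * c ^+ 2 + \sum_i x i ^+ 2.
    transitivity (\sum_i (c ^+ 2 + (2 * c * x i + x i ^+ 2))).
      by apply: eq_bigr => i _; ring.
    by rewrite !big_split/= sum_cst -[\sum_i 2 * c * x i]big_distrr/= sx mulr0
      add0r.
  have -> : \sum_i z i * x i = - (\sum_i a i * x i) + (\sum_i h i * x i) / P.
    transitivity (\sum_i (- (a i * x i) + h i * x i / P + k * x i)).
      by apply: eq_bigr => i _; rewrite /z; ring.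
    by rewrite !big_split/= sumrN -[\sum_i h i * x i / P]big_distrl -[\sum_i k
      * x i]big_distrr/= sx mulr0 addr0.
  by rewrite /h; field.
have ZE : Z = Q - 2 * (\sum_i a i * h i) / P + (\sum_i h i ^+ 2) / P ^+ 2
    - (S - U / P) ^+ 2 / P.
  transitivity (\sum_i (a i ^+ 2 + (- 2 / P) * (a i * h i) + (P ^+ 2)^-1 * h i
    ^+ 2
     + k ^+ 2 + (- 2 * k) * a i + (2 * k / P) * h i)).
    by apply: eq_bigr => i _; rewrite /z; field.
  rewrite !big_split/= -!big_distrr/= sum_cst -/S -/U -/Q /k.
  by field.
have P1 : 1 <= P by nra.
have S2' : S ^+ 2 <= (eta * P) ^+ 2.
  by rewrite (le_trans S2)// exprMn ler_wpM2l ?sqr_ge0// expr2 ler_peMr// ltW.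
have Seta : - (eta * P) <= S <= eta * P.
  rewrite -ler_norml -ler_sqr ?nnegrE// ?real_normK ?num_real//.
  by rewrite mulr_ge0// ltW.
have etaP0 : 0 < eta * P by rewrite mulr_gt0.
(* The signs [t = 1] and [t = -1] turn the one-sided inequality [sum_mul_le] into a bound on the
   absolute value. *)
have cross t : (t == 1) || (t == -1) ->
    t * (2 * (\sum_i a i * h i) / P) <= eta * Q + eta.
  move=> t1; have t2 : t ^+ 2 = 1 by case/orP: t1 => /eqP ->; ring.
  have := sum_mul_le (fun i => t * a i) h etaP0.
  have -> : \sum_i (t * a i) * h i = t * \sum_i a i * h i.
    by rewrite big_distrr/=; apply: eq_bigr => i _; rewrite mulrA.
  have -> : \sum_i (t * a i) ^+ 2 = Q.
    by apply: eq_bigr => i _; rewrite exprMn t2 mul1r.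
  have : (eta * P)^-1 * (\sum_i h i ^+ 2) <= eta * P.
    by rewrite ler_pdivrMl// -expr2.
  move=> h1 h2; rewrite mulrA ler_pdivrMr//; lra.
have hhP0 : 0 <= (\sum_i h i ^+ 2) / P ^+ 2.
  by rewrite divr_ge0 ?sqr_ge0//; apply: sumr_ge0 => i _; exact: sqr_ge0.
have hhP1 : (\sum_i h i ^+ 2) / P ^+ 2 <= eta ^+ 2.
  by rewrite ler_pdivrMr ?exprn_gt0// -exprMn.
have kk0 : 0 <= (S - U / P) ^+ 2 / P by rewrite divr_ge0 ?sqr_ge0// ltW.
have kk1 : (S - U / P) ^+ 2 / P <= 4 * eta ^+ 2.
  rewrite ler_pdivrMr//.
  have UP : - eta <= U / P <= eta.
    rewrite ler_pdivrMr// ler_pdivlMr//; apply/andP; split; lra.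
  have : (U / P) ^+ 2 <= eta ^+ 2 by case/andP: UP => ? ?; nra.
  have : 0 <= (S + U / P) ^+ 2 by exact: sqr_ge0.
  have : eta ^+ 2 <= eta ^+ 2 * P by rewrite ler_peMr// sqr_ge0.
  set r := U / P; nra.
have cross1 := cross 1 (introT orP (or_introl (eqxx _))).
have cross2 := cross (-1) (introT orP (or_intror (eqxx _))).
have eta1 : eta <= 1 / 20 by lra.
have eta2 : eta ^+ 2 <= eta / 20 by nra.
have etaQ : eta * Q <= (21 / 20) * eta by nra.
have Z_lo : y - 8 * eta <= Z by rewrite ZE; lra.
have Z_hi : Z <= y + 8 * eta by rewrite ZE; lra.
have Z0 : 0 <= Z by apply: sumr_ge0 => i _; exact: sqr_ge0.
clear ZE cross cross1 cross2 hhP0 hhP1 kk0 kk1.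
have [Slo Shi] : - (eta * P) <= S /\ S <= eta * P by apply/andP.
have sz2 : \sum_i (1 + z i) ^+ 2 = P + Z.
  transitivity (\sum_i (1 + 2 * z i + z i ^+ 2)).
    by apply: eq_bigr => i _; ring.
  by rewrite !big_split/= sum_cst mulr1 -big_distrr/= sz mulr0 addr0.
(* Lower bound: the trial vector 1 + z, where z is the component of M 1
   orthogonal to 1, divided by P. *)
rewrite ler_norml; apply/andP; split.
  have := lam_ge (fun i => 1 + z i); rewrite quadMs// sz2.
  have := Gpsd z; rewrite -/Z.
  rewrite expr1n !mul1r mulr1 => G0 le1.
  rewrite leNgt; apply/negP => lt1.
  have PZ0 : 0 < P + Z by rewrite ltr_pwDl.
  have lt2 : lambda * (P + Z) < (P + 1 + y - 2 * S - e) * (P + Z).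
    by rewrite ltr_pM2r//; lra.
  (* Here [2 <= eta * P] absorbs [1 + y], and [- 2 * S] costs another [2 * (eta * P)]. *)
  have h1 : Z * (1 + y - 2 * S - e) <= Z * (3 * (eta * P)).
    by apply: ler_wpM2l => //; lra.
  have h2 : Z * (3 * (eta * P)) <= (y + 8 * eta) * (3 * (eta * P)).
    by apply: ler_wpM2r => //; lra.
  have h3 : (y + 8 * eta) * (3 * (eta * P)) <= 2 * (3 * (eta * P)).
    by apply: ler_wpM2r; lra.
  have h4 : P * (y - 8 * eta) <= P * Z by rewrite ler_pM2l.
  rewrite eta20 in lt2 h1; clear - h1 h2 h3 h4 lt2 le1 G0 Ulo etaP0; lra.
suff : lambda <= P + 1 + y - 2 * S + e by lra.
(* Weight for Young's inequality on the cross term, chosen so that the coefficient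
   [th + 1 + eta * P] of the part orthogonal to 1 equals the claimed upper bound exactly. What
   remains is the coefficient of [c ^+ 2]. *)
pose th := P + y - 2 * S + e - eta * P.
have th0 : P * (1 - 3 * eta) <= th by rewrite /th; lra.
have th_gt0 : 0 < th by apply: lt_le_trans th0; rewrite mulr_gt0//; lra.
have Zth : P ^+ 2 * Z / th <= P * (y + e - eta).
  rewrite ler_pdivrMr// expr2 -!mulrA ler_pM2l//.
  have : P * Z <= P * (y + 8 * eta) by rewrite ler_pM2l.
  have : (y + e - eta) * (P * (1 - 3 * eta)) <= (y + e - eta) * th.
    by apply: ler_wpM2l => //; lra.
  have : P * (y + 8 * eta) <= P * ((y + e - eta) * (1 - 3 * eta)).
    by rewrite ler_pM2l//; nra.
  lra.
apply: lam_le => x.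
pose c := (\sum_i x i) / P; pose zeta i := x i - c.
have szeta : \sum_i zeta i = 0.
  by rewrite /zeta big_split/= sum_cst /c; field.
pose N := \sum_i zeta i ^+ 2.
have sx2 : \sum_i x i ^+ 2 = P * c ^+ 2 + N.
  transitivity (\sum_i (c ^+ 2 + 2 * c * zeta i + zeta i ^+ 2)).
    by apply: eq_bigr => i _; rewrite /zeta; ring.
  rewrite !big_split/= sum_cst -[\sum_i 2 * c * zeta i]big_distrr/= szeta.
  by rewrite mulr0 addr0.
have -> : quad M x = quad M (fun i => c + zeta i).
  by apply: eq_bigr => i _; apply: eq_bigr => j _; rewrite /zeta; ring.
rewrite quadMs// sx2 -/N.
have qH := quad_frobenius zeta etaP0 F; rewrite -/N in qH.
have thV : 0 < th^-1 by rewrite invr_gt0.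
have := sum_mul_le (fun i => c * P * z i) zeta thV; rewrite invrK -/N.
have -> : \sum_i (c * P * z i) * zeta i = c * P * \sum_i z i * zeta i.
  by rewrite big_distrr/=; apply: eq_bigr => i _; rewrite mulrA.
have -> : \sum_i (c * P * z i) ^+ 2 = (c * P) ^+ 2 * Z.
  by rewrite big_distrr/=; apply: eq_bigr => i _; rewrite exprMn.
move=> cr.
have c2 : 0 <= c ^+ 2 by exact: sqr_ge0.
have main : c ^+ 2 * (P ^+ 2 - 2 * P * S + P + U + P ^+ 2 * Z / th) <=
  c ^+ 2 * ((P + 1 + y - 2 * S + e) * P).
  by apply: ler_wpM2l => //; lra.
have -> : (P + 1 + y - 2 * S + e) * (P * c ^+ 2 + N) =
   c ^+ 2 * ((P + 1 + y - 2 * S + e) * P) + th * N + N + eta * P * N.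
  by rewrite /th; ring.
have e1' : th^-1 * ((c * P) ^+ 2 * Z) = c ^+ 2 * (P ^+ 2 * Z / th) by ring.
rewrite e1' in cr; lra.
Qed.

End TopEigenvalue.

Lemma continuous_sum (R : realType) (T : topologicalType) (I : finType)
    (F : I -> T -> R) :
  (forall i, continuous (F i)) -> continuous (fun x => \sum_i F i x).
Proof.
move=> Fc; have addc : continuous (fun x : R^o * R^o => x.1 + x.2).
  exact: add_continuous.
have := @continuous_big R^o I +%R 0 xpredT addc _ (index_enum I) F.
by apply=> i _; exact: Fc.
Qed.

(** * The largest eigenvalue as maximum of the Rayleigh quotient *)

Section LargestEigenvalue.
Variables (R : realType).

Local Notation mq M x := (quad (fun i j => M i j) (fun i => x 0 i)).

Lemma continuous_quad p (M : 'M[R]_p) : continuous (fun x : 'rV[R]_p => mq M x).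
Proof.
rewrite /quad; apply: continuous_sum => i.
apply: continuous_sum => j x.
have ci := @coord_continuous R 1 p 0 i x.
have cj := @coord_continuous R 1 p 0 j x.
exact: (cvgM (cvgM ci (cvg_cst _)) cj).
Qed.

Lemma compact_sphere p :
  compact [set x : 'rV[R]_p | \sum_i x 0 i ^+ 2 = 1].
Proof.
apply: bounded_closed_compact.
  exists 1; split; first exact: num_real.
  move=> M M1 x /= x1; apply/ltW/(le_lt_trans _ M1).
  rewrite [leLHS]/Num.norm/= mx_normrE; apply: bigmax_le => //= -[i j] _ /=.
  rewrite -(expr_le1 (n := 2))// real_normK ?num_real// -x1 (ord1 i).
  by rewrite (bigD1 j)//= lerDl; apply: sumr_ge0 => k _; exact: sqr_ge0.
have -> : [set x : 'rV[R]_p | \sum_i x 0 i ^+ 2 = 1] =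
   (fun x : 'rV[R]_p => \sum_i x 0 i ^+ 2) @^-1` [set 1] by [].
apply: preimage_closed; last exact: closed_eq.
move=> x _; apply: continuous_sum => i {}x.
have ci := @coord_continuous R 1 p 0 i x.
exact: (cvgM ci ci).
Qed.

Lemma exists_max_rayleigh p (M : 'M[R]_p) : (0 < p)%N ->
  exists2 c : 'rV[R]_p, \sum_i c 0 i ^+ 2 = 1 &
    forall x : 'rV[R]_p, mq M x <= mq M c * (\sum_i x 0 i ^+ 2).
Proof.
move=> p0.
have [|c] := EVT_max_rV _ (@compact_sphere p)
   (continuous_subspaceT (@continuous_quad p M)).
  exists (delta_mx 0 (Ordinal p0)) => /=.
  rewrite (bigD1 (Ordinal p0))//= mxE !eqxx expr1n big1 ?addr0// => j.
  by move=> /negbTE jp; rewrite mxE jp andbF expr0n.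
rewrite inE/= => c1 cmax; exists c => // x.
set N := \sum_i _.
have N0 : 0 <= N by apply: sumr_ge0 => i _; exact: sqr_ge0.
have [N_eq0|N_neq0] := eqVneq N 0.
  have x0 i : x 0 i = 0.
    have /psumr_eq0P := N_eq0.
    move=> /(_ (fun i _ => sqr_ge0 _))/(_ i isT)/eqP.
    by rewrite sqrf_eq0 => /eqP.
  rewrite N_eq0 mulr0 /quad big1// => i _; rewrite big1// => j _.
  by rewrite x0 !mul0r.
have N_gt0 : 0 < N by rewrite lt_def N_neq0.
have r2 : Num.sqrt N ^+ 2 = N by rewrite sqr_sqrtr.
have := cmax ((Num.sqrt N)^-1 *: x).
have -> : mq M ((Num.sqrt N)^-1 *: x) = N^-1 * mq M x.
  rewrite -[in RHS]r2 -exprVn -quadZ; congr quad.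
  by apply/funext => i; rewrite mxE.
rewrite ler_pdivrMl// mulrC; apply; rewrite inE/=.
under eq_bigr do rewrite mxE exprMn exprVn r2.
by rewrite -big_distrr/= mulVf.
Qed.

Lemma quad_eigen p (M : 'M[R]_p) (v : 'rV[R]_p) (l : R) : v *m M = l *: v ->
  mq M v = l * \sum_i v 0 i ^+ 2.
Proof.
move=> vM; rewrite /quad exchange_big big_distrr/=; apply: eq_bigr => j _.
have := congr1 (fun w : 'rV[R]_p => w 0 j) vM; rewrite !mxE => vMj.
by rewrite -big_distrl/= vMj; ring.
Qed.

(** The form of l - M is nonnegative and vanishes at [c], so [c] minimises it. Its first variation
    at [c] in the direction r = (l - M) c is twice the squared length of r, which must therefore be
    zero. *)
Lemma max_rayleigh_eigen p (M : 'M[R]_p) (c : 'rV[R]_p) (l : R) : M^T = M ->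
  mq M c = l * (\sum_i c 0 i ^+ 2) ->
  (forall x : 'rV[R]_p, mq M x <= l * (\sum_i x 0 i ^+ 2)) ->
  c *m M = l *: c.
Proof.
move=> Msym cl max.
pose N := fun i j => l * (i == j)%:R - M i j.
have NE (x : 'I_p -> R) : quad N x = l * (\sum_i x i ^+ 2) - quad (fun i j =>
  M i j) x.
  rewrite /quad big_distrr -sumrB/=; apply: eq_bigr => i _.
  transitivity (\sum_j (l * x i * ((i == j)%:R * x j) - x i * M i j * x j)).
    by apply: eq_bigr => j _; rewrite /N; ring.
  rewrite sumrB; congr (_ - _); rewrite -big_distrr/= (bigD1 i)//= eqxx mul1r.
  rewrite big1 ?addr0; first by ring.
  by move=> j; rewrite eq_sym => /negbTE ->; rewrite mul0r.
have N_ge0 (x : 'I_p -> R) : 0 <= quad N x.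
  rewrite NE subr_ge0; have := max (\row_i x i).
  rewrite (_ : (fun i => _) = x); last by apply/funext => i; rewrite mxE.
  by under eq_bigr do rewrite mxE.
have Nsym i j : N i j = N j i.
  by rewrite /N eq_sym -[in LHS]Msym mxE.
pose r i := \sum_j N i j * c 0 j.
have rE i : r i = \sum_j N i j * c 0 j by [].
clearbody r.
have Nc0 : quad N (c 0) = 0 by rewrite NE cl subrr.
have quadDt t : quad N (fun i => c 0 i + t * r i) =
   2 * t * (\sum_i r i ^+ 2) + t ^+ 2 * quad N r.
  transitivity (quad N (c 0) + (2 * t * (\sum_i r i ^+ 2) +
      quad N (fun i => t * r i))); last by rewrite Nc0 add0r quadZ.
  have -> : \sum_i r i ^+ 2 = \sum_i \sum_j r i * N i j * c 0 j.
    apply: eq_bigr => i _; rewrite expr2 {2}rE big_distrr/=.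
    by apply: eq_bigr => j _; rewrite mulrA.
  have e1 : \sum_i \sum_j r i * N i j * c 0 j = \sum_i \sum_j c 0 i * N i j *
    r j.
    rewrite exchange_big/=; apply: eq_bigr => i _; apply: eq_bigr => j _.
    by rewrite (Nsym j i); ring.
  rewrite (_ : 2 * t * _ = t * (\sum_i \sum_j r i * N i j * c 0 j) +
       t * (\sum_i \sum_j c 0 i * N i j * r j)); last by rewrite -e1; ring.
  rewrite /quad !big_distrr -!big_split/=; apply: eq_bigr => i _.
  rewrite !big_distrr -!big_split/=; apply: eq_bigr => j _; ring.
have rr0 : \sum_i r i ^+ 2 = 0.
  apply/eqP; rewrite eq_le; apply/andP; split; last first.
    by apply: sumr_ge0 => i _; exact: sqr_ge0.
  rewrite leNgt; apply/negP => rr_gt0.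
  set d := \sum_i r i ^+ 2 in rr_gt0 quadDt.
  have q0 := N_ge0 r; set q := quad N r in q0 quadDt.
  (* The optimal step would be [- d / q]; using [q + 1] keeps the denominator positive when [q = 0]
     and still makes the value negative. *)
  have := N_ge0 (fun i => c 0 i + - (d / (q + 1)) * r i); rewrite quadDt.
  have -> : 2 * - (d / (q + 1)) * d + (- (d / (q + 1))) ^+ 2 * q =
     - (d ^+ 2 * (q + 2) / (q + 1) ^+ 2).
    by field; rewrite gt_eqF// ltr_wpDl.
  rewrite oppr_ge0 leNgt => /negP; apply.
  by rewrite divr_gt0 ?mulr_gt0 ?exprn_gt0 ?ltr_wpDl.
apply/rowP => i; rewrite !mxE.
have : r i = 0.
  have /psumr_eq0P := rr0.
  move=> /(_ (fun i _ => sqr_ge0 _))/(_ i isT)/eqP.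
  by rewrite sqrf_eq0 => /eqP.
rewrite rE; under eq_bigr => j _ do rewrite /N mulrBl.
rewrite sumrB => /eqP; rewrite subr_eq0 => /eqP E.
have -> : \sum_j c 0 j * M j i = \sum_j M i j * c 0 j.
  by apply: eq_bigr => j _; rewrite mulrC -[in LHS]Msym mxE.
rewrite -E (bigD1 i)//= eqxx mulr1 big1 ?addr0// => j.
by rewrite eq_sym => /negbTE ->; rewrite mulr0 mul0r.
Qed.

(** The [sup] has to be identified as a maximum: a maximiser of the Rayleigh quotient is an
    eigenvector, and every eigenvalue is a Rayleigh quotient. The two conclusions are the form in
    which [top_eigenvalue_expansion] takes [lambda]. *)
Lemma largest_eigenvalueP p (M : 'M[R]_p) : (0 < p)%N -> M^T = M ->
  (forall x : 'I_p -> R, quad (fun i j => M i j) x <=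
     largest_eigenvalue M * \sum_i x i ^+ 2) /\
  (forall b, (forall x : 'I_p -> R, quad (fun i j => M i j) x <=
     b * \sum_i x i ^+ 2) -> largest_eigenvalue M <= b).
Proof.
move=> p0 Msym; have [c c1 cmax] := exists_max_rayleigh M p0.
set l := mq M c in cmax.
have cM : c *m M = l *: c by apply: max_rayleigh_eigen => //; rewrite c1 mulr1.
have c_neq0 : c != 0.
  apply/eqP => c0; move: c1; rewrite c0 big1 => [/esym/eqP|i _].
    by rewrite oner_eq0.
  by rewrite mxE expr0n.
have lmax : [set a | eigenvalue M a] l.
  by apply/eigenvalueP; exists c.
have lub : ubound [set a | eigenvalue M a] l.
  move=> a /= /eigenvalueP[v vM v0].
  have v_gt0 : 0 < \sum_i v 0 i ^+ 2.
    rewrite lt_def; apply/andP; split; last first.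
      by apply: sumr_ge0 => i _; exact: sqr_ge0.
    apply/eqP => v_0; move/eqP: v0; apply; apply/rowP => i; rewrite mxE.
    have /psumr_eq0P := v_0.
    move=> /(_ (fun i _ => sqr_ge0 _))/(_ i isT)/eqP.
    by rewrite sqrf_eq0 => /eqP.
  by rewrite -(ler_pM2r v_gt0) -(quad_eigen vM).
have lE : largest_eigenvalue M = l.
  apply/eqP; rewrite eq_le; apply/andP; split.
    by apply: ge_sup => //; exists l.
  by apply: ub_le_sup => //; exists l.
rewrite lE; split => [x|b bmax].
  have := cmax (\row_i x i).
  rewrite (_ : (fun i => _) = x); last by apply/funext => i; rewrite mxE.
  by under eq_bigr do rewrite mxE.
by have := bmax (c 0); rewrite c1 mulr1.
Qed.

End LargestEigenvalue.

(** * Moments of a random codeword *)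

Section Signs.
Variable R : realType.

Definition sgn (x : 'F_2) : R := (-1) ^+ x.

Lemma sgn0 : sgn 0 = 1. Proof. by rewrite /sgn expr0. Qed.

Lemma sgn1 : sgn 1 = -1. Proof. by []. Qed.

Lemma sgnD x y : sgn (x + y) = sgn x * sgn y.
Proof. by rewrite /sgn -exprD -[RHS]signr_odd -modn2. Qed.

Lemma sgn_sqr x : sgn x ^+ 2 = 1.
Proof. by rewrite /sgn sqrr_sign. Qed.

Lemma F2_cases (x : 'F_2) : x = 0 \/ x = 1.
Proof. by case: x => -[|[|//]] H; [left|right]; apply: val_inj. Qed.

Lemma natr_sgn (x : 'F_2) : (nat_of_ord x)%:R = (1 - sgn x) / 2 :> R.
Proof.
case: (F2_cases x) => ->; rewrite ?sgn0 ?sgn1; first by rewrite subrr mul0r.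
by rewrite (_ : nat_of_ord _ = 1%N)//; field.
Qed.

Lemma sgn_le1 x : sgn x <= 1.
Proof.
by case: (F2_cases x) => ->; rewrite ?sgn0 ?sgn1//; lra.
Qed.

End Signs.

(** * Mixed moments of the coordinates of one row *)

Section Rows.
Variables (R : realType) (n : nat) (C : {vspace 'rV['F_2]_n}).
Hypothesis dualC : (5%:R%:E <= dual_distance R C)%E.

(** The uniform law on [C] is extended by zero to all row vectors, so that sums run over one fixed
    finite type. *)
Definition code_weight (u : 'rV['F_2]_n) : R :=
  if u \in C then (#|C|%:R)^-1 else 0.

Lemma code_weight_ge0 u : 0 <= code_weight u.
Proof. by rewrite /code_weight; case: ifP. Qed.

Lemma code_weight_sum1 : \sum_u code_weight u = 1.
Proof.
rewrite /code_weight -big_mkcond/= sumr_const -[_ *+ _]mulr_natr mulVf//.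
by rewrite pnatr_eq0 -lt0n; apply/card_gt0P; exists 0; exact: mem0v.
Qed.

Lemma not_dual_small (v : 'rV['F_2]_n) :
  v != 0 -> (#|[pred i | v 0%R i != 0%R]| <= 4)%N -> ~ dual_code C v.
Proof.
move=> v0 v4 dv; have : ((5%:R)%:E <= (hamming_dist v 0)%:R%:E :> \bar R)%E.
  apply: le_trans dualC _; apply: ereal_inf_lbound; exists v, 0; split=> //.
  by move=> u _; rewrite big1// => i _; rewrite mxE mulr0.
rewrite lee_fin ler_nat leqNgt ltnS /hamming_dist => /negP; apply.
apply: leq_trans v4; apply: eq_leq; apply: eq_card => i.
by rewrite !inE mxE.
Qed.

(** A codeword [c] not orthogonal to [v] exists; translation by [c] preserves the uniform law on [C]
    and flips the character, so the mean equals its own negative. *)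
Lemma mean_char (v : 'rV['F_2]_n) : ~ dual_code C v ->
  mean code_weight (fun u => sgn R (\sum_i u 0 i * v 0 i)) = 0.
Proof.
move=> /existsNP[c /not_implyP[cC cv]].
have {}cv : \sum_i c 0 i * v 0 i = 1 by case: (F2_cases (\sum_i c 0 i * v 0 i)).
set T := mean _ _; suff : T = - T by move=> TN; lra.
rewrite {1}/T /mean (reindex_inj (addIr c))/= -mulN1r big_distrr/=.
apply: eq_bigr => u _.
have -> : code_weight (u + c) = code_weight u.
  by rewrite /code_weight rpredDr.
have -> : \sum_i (u + c) 0 i * v 0 i = \sum_i u 0 i * v 0 i + 1.
  by rewrite -cv -big_split/=; apply: eq_bigr => i _; rewrite mxE mulrDl.
by rewrite sgnD sgn1; ring.
Qed.

Definition eps (u : 'rV['F_2]_n) (k : 'I_n) : R := sgn R (u 0 k).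

(** The product over a list with repetitions is the character of the vector of multiplicities mod 2.
    Its support has at most 4 elements and contains [k], so it is not in the dual code. *)
Lemma mean_prod_eps (s : seq 'I_n) (k : 'I_n) :
  (size s <= 4)%N -> odd (count_mem k s) ->
  mean code_weight (fun u => \prod_(j <- s) eps u j) = 0.
Proof.
move=> s4 ks; pose v : 'rV['F_2]_n := \row_i (count_mem i s)%:R.
rewrite -(@mean_char v); last first.
  apply: not_dual_small.
    apply/eqP => /rowP/(_ k); rewrite !mxE => /(congr1 val).
    by rewrite [LHS]val_Fp_nat// modn2 ks.
  apply: leq_trans s4; apply: leq_trans (card_size s).
  apply: subset_leq_card; apply/fintype.subsetP => i; rewrite !inE mxE.
  by apply: contraR => /count_memPn ->.
apply: eq_mean => u; rewrite /v /eps.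
transitivity (sgn R (\sum_(j <- s) u 0 j)).
  elim: s {s4 ks v} => [|j s IH]; first by rewrite !big_nil sgn0.
  by rewrite !big_cons sgnD IH.
congr sgn.
elim: s {s4 ks v} => [|j s IH].
  by rewrite big_nil big1// => i _; rewrite mxE mulr0.
rewrite big_cons IH (bigD1 j)//= [in RHS](bigD1 j)//= !mxE/= eqxx natrD mulrDr
  mulr1 -addrA.
congr (_ + (_ + _)); apply: eq_bigr => i ij; rewrite !mxE/=.
by rewrite eq_sym (negbTE ij).
Qed.

Local Notation E1 := (mean code_weight).

Lemma eps_sqr u k : eps u k ^+ 2 = 1. Proof. exact: sgn_sqr. Qed.

Lemma mean_eps k : E1 (eps ^~ k) = 0.
Proof.
apply: etrans (@mean_prod_eps [:: k] k _ _) => //=; last by rewrite eqxx.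
by apply: eq_mean => u; rewrite big_seq1.
Qed.

Lemma mean_eps2 k l : E1 (fun u => eps u k * eps u l) = (k == l)%:R.
Proof.
have [<-|kl] := eqVneq k l.
  under eq_mean do rewrite -expr2 eps_sqr.
  by rewrite mean_cst// code_weight_sum1.
apply: etrans (@mean_prod_eps [:: k; l] k _ _) => //=; last first.
  by rewrite eqxx eq_sym (negbTE kl).
by apply: eq_mean => u; rewrite !big_cons big_nil mulr1.
Qed.

(** The right side counts the three pairings of four indices, as in Wick's formula. If some pairing
    matches, the trivial bound 1 suffices; if none does, an index of odd multiplicity makes the
    moment vanish. *)
Lemma mean_eps4_le k l m r :
  E1 (fun u => eps u k * eps u l * eps u m * eps u r) <=
  (k == l)%:R * (m == r)%:R + (k == m)%:R * (l == r)%:R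
    + (k == r)%:R * (l == m)%:R.
Proof.
have le1 : E1 (fun u => eps u k * eps u l * eps u m * eps u r) <= 1.
  rewrite -(mean_cst code_weight_sum1 1); apply: ler_mean => [|u].
    exact: code_weight_ge0.
  by rewrite -!sgnD sgn_le1.
have eq0 j : odd (count_mem j [:: k; l; m; r]) ->
    E1 (fun u => eps u k * eps u l * eps u m * eps u r) = 0.
  move=> oj; apply: etrans (mean_prod_eps _ oj) => //; apply: eq_mean => u.
  by rewrite !big_cons big_nil mulr1 !mulrA.
have nn (b1 b2 : bool) : 0 <= b1%:R * b2%:R :> R by rewrite mulr_ge0.
have [p1|] := boolP ((k == l) && (m == r)).
  case/andP: p1 => -> ->; rewrite mulr1 (le_trans le1)// -addrA lerDl.
  by rewrite addr_ge0.
have [p1 _|] := boolP ((k == m) && (l == r)).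
  case/andP: p1 => -> ->; rewrite mulr1 (le_trans le1)// -addrA addrCA lerDl.
  by rewrite addr_ge0.
have [p1 _ _|] := boolP ((k == r) && (l == m)).
  by case/andP: p1 => -> ->; rewrite mulr1 (le_trans le1)// lerDr addr_ge0.
move=> h3 h2 h1.
suff [j /eq0 ->] : exists j, odd (count_mem j [:: k; l; m; r]).
  by rewrite !addr_ge0.
have [kl|kl] := eqVneq k l.
  move: h3 h2 h1; rewrite -{}kl !eqxx/= => h3 h2 h1.
  have [mk|mk] := eqVneq m k.
    by exists r; rewrite /= mk eqxx -mk (negbTE h1).
  by exists m; rewrite /= eqxx !(eq_sym k) (negbTE mk) eq_sym (negbTE h1).
have [km|km] := eqVneq k m.
  move: h3 h2 h1; rewrite -{}km !eqxx/= => h3 h2 h1.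
  by exists l; rewrite /= eqxx (negbTE kl) eq_sym (negbTE h2).
have [kr|kr] := eqVneq k r.
  move: h3 h2 h1; rewrite -{}kr !eqxx/= => h3 h2 h1.
  by exists l; rewrite /= eqxx (negbTE kl) eq_sym (negbTE h3).
by exists k; rewrite /= eqxx !(eq_sym _ k) (negbTE kl) (negbTE km) (negbTE kr).
Qed.

Definition row_avg (u : 'rV['F_2]_n) : R := (\sum_k eps u k) / n%:R.

Lemma row_avgE u : row_avg u = n%:R^-1 * \sum_k eps u k.
Proof. by rewrite mulrC. Qed.

Lemma mean_row_avg : E1 row_avg = 0.
Proof.
rewrite (eq_mean _ row_avgE) meanZ mean_sum big1 ?mulr0// => k _.
exact: mean_eps.
Qed.

Lemma sum_delta (k : 'I_n) (f : 'I_n -> R) : \sum_l (k == l)%:R * f l = f k.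
Proof.
rewrite (bigD1 k)//= eqxx mul1r big1 ?addr0// => l.
by rewrite eq_sym => /negbTE ->; rewrite mul0r.
Qed.

Lemma sum_delta1 (k : 'I_n) : \sum_l (k == l)%:R = 1 :> R.
Proof. by rewrite -[RHS](sum_delta k (fun=> 1)); apply: eq_bigr => l _;
  rewrite mulr1. Qed.

Lemma sum1_n : \sum_(k < n) 1 = n%:R :> R.
Proof. by rewrite sumr_const card_ord. Qed.

Definition row_gram (u v : 'rV['F_2]_n) : R :=
  n%:R^-1 * \sum_k eps u k * eps v k.

Lemma row_gramC u v : row_gram u v = row_gram v u.
Proof. by congr (_ * _); apply: eq_bigr => k _; rewrite mulrC. Qed.

Lemma mean_row_gram v : E1 (row_gram ^~ v) = 0.
Proof.
rewrite meanZ mean_sum big1 ?mulr0// => k _.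
under eq_mean do rewrite mulrC.
by rewrite meanZ mean_eps mulr0.
Qed.

(** The signs of a random row have the identity as covariance, so averaging over [u] contracts the
    two inner products into one. *)
Lemma mean_row_gram2 v v' :
  E1 (fun u => row_gram u v * row_gram u v') = n%:R^-1 * row_gram v v'.
Proof.
transitivity (E1 (fun u => n%:R^-1 ^+ 2 *
    \sum_k \sum_l eps v k * eps v' l * (eps u k * eps u l))).
  apply: eq_mean => u; rewrite /row_gram.
  transitivity (n%:R^-1 ^+ 2 * ((\sum_k eps u k * eps v k) * \sum_k eps u k *
    eps v' k)).
    by ring.
  congr (_ * _); rewrite big_distrl/=; apply: eq_bigr => k _.
  by rewrite big_distrr/=; apply: eq_bigr => l _; ring.
rewrite meanZ mean_sum expr2 -mulrA; congr (_ * (_ * _)).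
apply: eq_bigr => k _;
  rewrite mean_sum -(sum_delta k (fun l => eps v k * eps v' l)).
by apply: eq_bigr => l _; rewrite meanZ mean_eps2 mulrC.
Qed.

Hypothesis n_gt0 : (0 < n)%N.

Let nR_neq0 : n%:R != 0 :> R. Proof. by rewrite pnatr_eq0 -lt0n. Qed.

Lemma row_gram_self u : row_gram u u = 1.
Proof.
rewrite /row_gram; under eq_bigr do rewrite -expr2 eps_sqr.
by rewrite sum1_n mulVf.
Qed.

Lemma mean_row_avg2 : E1 (fun u => row_avg u ^+ 2) = n%:R^-1.
Proof.
transitivity (E1 (fun u => n%:R^-1 ^+ 2 * \sum_k \sum_l eps u k * eps u l)).
  apply: eq_mean => u; rewrite row_avgE exprMn; congr (_ * _).
  by rewrite expr2 big_distrl/=; apply: eq_bigr => k _; rewrite big_distrr.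
rewrite meanZ mean_sum (eq_bigr (fun=> 1)) => [|k _].
  by rewrite sum1_n; field.
rewrite mean_sum -(sum_delta1 k).
by apply: eq_bigr => l _; rewrite mean_eps2.
Qed.

(** Each of the three pairings contributes n^2 of the n^4 index quadruples. This is the constant 3
    required of the fourth moment in [clt_data]. *)
Lemma mean_row_avg4 : E1 (fun u => row_avg u ^+ 4) <= 3 * n%:R^-1 ^+ 2.
Proof.
have -> : E1 (fun u => row_avg u ^+ 4) = E1 (fun u => n%:R^-1 ^+ 4 *
    \sum_k \sum_l \sum_m \sum_r eps u k * eps u l * eps u m * eps u r).
  apply: eq_mean => u; rewrite row_avgE exprMn; congr (_ * _).
  transitivity (\sum_k eps u k * (\sum_l eps u l * (\sum_m eps u m * (\sum_r
    eps u r)))).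
    by rewrite -!big_distrl/=; ring.
  apply: eq_bigr => k _; rewrite [LHS]big_distrr/=; apply: eq_bigr => l _.
  rewrite mulrA [LHS]big_distrr/=; apply: eq_bigr => m _.
  by rewrite mulrA [LHS]big_distrr/=; apply: eq_bigr => r _.
rewrite meanZ.
have -> : 3 * n%:R^-1 ^+ 2 = n%:R^-1 ^+ 4 * \sum_(k < n) \sum_(l < n) \sum_(m
  < n) \sum_(r < n)
   ((k == l)%:R * (m == r)%:R + (k == m)%:R * (l == r)%:R
    + (k == r)%:R * (l == m)%:R) :> R.
  have inner (k l : 'I_n) : \sum_(m < n) \sum_(r < n)
     ((k == l)%:R * (m == r)%:R + (k == m)%:R * (l == r)%:R
    + (k == r)%:R * (l == m)%:R) = n%:R * (k == l)%:R + 2 :> R.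
    transitivity (\sum_(m < n) ((k == l)%:R + (k == m)%:R + (l == m)%:R : R)).
      apply: eq_bigr => m _.
      by rewrite !big_split/= -!big_distrr -big_distrl/= !sum_delta1 !mulr1
        mul1r.
    by rewrite !big_split/= !sum_delta1 sumr_const card_ord mulr_natl -addrA.
  transitivity (n%:R^-1 ^+ 4 * \sum_(k < n) \sum_(l < n) (n%:R * (k == l)%:R +
    2) : R).
    transitivity (n%:R^-1 ^+ 4 * \sum_(k < n) (3 * n%:R) : R).
      by rewrite sumr_const card_ord -[_ *+ n]mulr_natl; field.
    congr (_ * _); apply: eq_bigr => k _.
    rewrite big_split/= -big_distrr/= sum_delta1 sumr_const card_ord.
    by rewrite -[_ *+ n]mulr_natl; ring.
  congr (_ * _); apply: eq_bigr => k _; apply: eq_bigr => l _.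
  by rewrite inner.
rewrite ler_wpM2l//.
rewrite mean_sum; apply: ler_sum => k _.
rewrite mean_sum; apply: ler_sum => l _.
rewrite mean_sum; apply: ler_sum => m _.
rewrite mean_sum; apply: ler_sum => r _.
exact: mean_eps4_le.
Qed.

End Rows.

(** * Second moments for a matrix of independent rows *)

Section MatrixMoments.
Variables (R : realType) (n : nat) (C : {vspace 'rV['F_2]_n}) (p : nat).
Hypotheses (dualC : (5%:R%:E <= dual_distance R C)%E) (n_gt0 : (0 < n)%N).

Local Notation w := (code_weight R C).
Local Notation E := (@prod_mean R 'rV['F_2]_n 'I_p w).
Local Notation config := {ffun 'I_p -> 'rV['F_2]_n}.
Implicit Types (X : config) (i j k l : 'I_p).

Let w_sum1 := code_weight_sum1 R C.

(** This is G - I: signs square to 1, so the diagonal of G is exactly 1 and nothing is lost by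
    putting zeros there. *)
Definition off_gram X i j : R :=
  if i == j then 0 else row_gram R (X i) (X j).

Lemma off_gramC X i j : off_gram X i j = off_gram X j i.
Proof. by rewrite /off_gram eq_sym row_gramC. Qed.

Lemma mean_off_gram2 i j : i != j -> E (fun X => off_gram X i j ^+ 2) = n%:R^-1.
Proof.
move=> ij; rewrite (prod_mean_resample w_sum1 i) -[RHS](prod_mean_cst 'I_p
  w_sum1).
apply: eq_prod_mean => X; rewrite /off_gram (negbTE ij).
transitivity (mean w (fun z => row_gram R z (X j) * row_gram R z (X j))).
  by apply: eq_mean => z; rewrite resample_same resample_other 1?eq_sym// expr2.
by rewrite mean_row_gram2// row_gram_self// mulr1.
Qed.

(** Row [i] occurs only once, so averaging over it with the other rows fixed already gives zero. *)
Lemma row_gram_orthogonal i j k l : i != j -> i != k -> i != l ->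
  E (fun X => row_gram R (X i) (X j) * row_gram R (X k) (X l)) = 0.
Proof.
move=> ij ik il; rewrite (prod_mean_resample w_sum1 i).
rewrite -[RHS](prod_mean_cst 'I_p w_sum1); apply: eq_prod_mean => X.
transitivity (mean w (fun z => row_gram R (X k) (X l) * row_gram R z (X j))).
  apply: eq_mean => z; rewrite resample_same !resample_other 1?eq_sym//.
  by rewrite mulrC.
by rewrite meanZ mean_row_gram// mulr0.
Qed.

Lemma off_gram_rowE X i :
  \sum_j off_gram X i j = \sum_(j | j != i) row_gram R (X i) (X j).
Proof.
rewrite [RHS]big_mkcond/=; apply: eq_bigr => j _.
by rewrite /off_gram eq_sym; case: eqVneq.
Qed.

Lemma mean_off_gram_row2 i :
  E (fun X => (\sum_j off_gram X i j) ^+ 2) <= p%:R / n%:R.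
Proof.
under eq_prod_mean do rewrite off_gram_rowE.
rewrite prod_mean_sqr_sum => [|j k ji ki jk]; last first.
  under eq_prod_mean => X do rewrite (row_gramC _ (X i) (X j)).
  exact: row_gram_orthogonal.
rewrite (eq_bigr (fun=> n%:R^-1)) => [|j ji].
  rewrite sumr_const -[_ *+ _]mulr_natl ler_wpM2r//.
  by rewrite ler_nat (leq_trans (max_card _))// card_ord.
rewrite -(@mean_off_gram2 i j) 1?eq_sym//; apply: eq_prod_mean => X.
by rewrite /off_gram eq_sym (negbTE ji).
Qed.

(** Over ordered pairs the entries [(i, j)] and [(j, i)] coincide and are not orthogonal;
    restricting to [i < j] makes [prod_mean_sqr_sum] applicable. *)
Lemma sum_off_gramE X : \sum_i \sum_j off_gram X i j =
  2 * \sum_(q : 'I_p * 'I_p | (q.1 < q.2)%N) row_gram R (X q.1) (X q.2).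
Proof.
rewrite pair_big/= (bigID (fun q : 'I_p * 'I_p => (q.1 < q.2)%N))/=.
have lt_off (i j : 'I_p) : (i < j)%N -> off_gram X i j = row_gram R (X i) (X j).
  by move=> ij; rewrite /off_gram ifN// -val_eqE neq_ltn ij.
rewrite (eq_bigr (fun q : 'I_p * 'I_p => row_gram R (X q.1) (X q.2))) => [|q].
  rewrite -[2]/(1 + 1) mulrDl mul1r; congr (_ + _).
  rewrite (reindex_inj (h := fun q : 'I_p * 'I_p => (q.2, q.1)))/=; last first.
    by move=> [a b] [c d] [-> ->].
  rewrite big_mkcond [RHS]big_mkcond/=; apply: eq_bigr => -[i j] _ /=.
  rewrite -leqNgt leq_eqVlt; case: ltngtP => //= [ij|ij].
    by rewrite off_gramC lt_off.
  by rewrite /off_gram (val_inj ij) eqxx.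
exact: lt_off.
Qed.

Lemma mean_sum_off_gram2 :
  E (fun X => (\sum_i \sum_j off_gram X i j) ^+ 2) <= 4 * p%:R ^+ 2 / n%:R.
Proof.
under eq_prod_mean do rewrite sum_off_gramE exprMn.
rewrite prod_meanZ prod_mean_sqr_sum => [|[i j] [k l]/= ij kl]; last first.
  rewrite xpair_eqE negb_and => neq.
  have nij : i != j by rewrite -val_eqE neq_ltn ij.
  have nkl : k != l by rewrite -val_eqE neq_ltn kl.
  have [ik|ik] := eqVneq i k; last first.
    have [il|il] := eqVneq i l; last exact: row_gram_orthogonal.
    (* Distinct increasing pairs share at most one row, so some row occurs once. With [i = l],
       equality [j = k] would make one pair the reversal of the other, which the ordering
       forbids. *)
    have jk : j != k.
      by apply/eqP => jk; move: kl; rewrite -jk -il ltnNge ltnW.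
    under eq_prod_mean => X do rewrite (row_gramC _ (X i) (X j)).
    by apply: row_gram_orthogonal; rewrite // 1?eq_sym// -il.
  move: neq; rewrite ik eqxx/= => jl.
  under eq_prod_mean => X do rewrite (row_gramC _ _ (X j)).
  by apply: row_gram_orthogonal; rewrite // eq_sym// -ik.
rewrite (eq_bigr (fun=> n%:R^-1)) => [|[i j]/= ij]; last first.
  have nij : i != j by rewrite -val_eqE neq_ltn ij.
  rewrite -(mean_off_gram2 nij); apply: eq_prod_mean => X.
  by rewrite /off_gram (negbTE nij).
rewrite sumr_const -[n%:R^-1 *+ _]mulr_natl mulrA ler_wpM2r//.
have -> : 2 ^+ 2 = 4 :> R by ring.
rewrite ler_wpM2l// -natrX ler_nat (leq_trans (max_card _))//.
by rewrite card_prod card_ord.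
Qed.

Lemma mean_sum_row_avg2 :
  E (fun X => (\sum_i row_avg R (X i)) ^+ 2) = p%:R / n%:R.
Proof.
rewrite prod_mean_sqr_sum => [|i j _ _ ij]; last first.
  rewrite (prod_mean_indep w_sum1 (@row_avg R n) (h := fun X => row_avg R (X
    j))).
    by rewrite mean_row_avg// mul0r.
  by move=> X z; rewrite resample_other// eq_sym.
rewrite (eq_bigr (fun=> n%:R^-1)) => [|i _].
  by rewrite sumr_const card_ord -[_ *+ _]mulr_natl.
by rewrite (prod_mean_coord w_sum1 i (fun z => row_avg R z ^+ 2)) mean_row_avg2.
Qed.

(** The summands are centred by their mean 1/n, and the variance of a square is at most the fourth
    moment; the p independent variances add up. *)
Lemma mean_sum_sqr_row_avg :
  E (fun X => (\sum_i row_avg R (X i) ^+ 2 - p%:R / n%:R) ^+ 2) <=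
    3 * p%:R / n%:R ^+ 2.
Proof.
pose f (z : 'rV['F_2]_n) := row_avg R z ^+ 2 + - n%:R^-1.
have f1 : mean w f = 0.
  by rewrite meanD mean_row_avg2// mean_cst// subrr.
have f2 : mean w (fun z => f z ^+ 2) <= 3 * n%:R^-1 ^+ 2.
  apply: le_trans (mean_row_avg4 dualC n_gt0).
  have -> : mean w (fun z => f z ^+ 2) =
      mean w (fun z => row_avg R z ^+ 4 + (- 2 / n%:R * row_avg R z ^+ 2 +
        n%:R^-1 ^+ 2)).
    by apply: eq_mean => z; rewrite /f; ring.
  rewrite !meanD meanZ mean_row_avg2// mean_cst// gerDl.
  have -> : - 2 / n%:R * n%:R^-1 + n%:R^-1 ^+ 2 = - (n%:R^-1 ^+ 2) :> R by ring.
  by rewrite oppr_le0 sqr_ge0.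
have -> : E (fun X => (\sum_i row_avg R (X i) ^+ 2 - p%:R / n%:R) ^+ 2) =
    E (fun X => (\sum_i f (X i)) ^+ 2).
  apply: eq_prod_mean => X; rewrite /f big_split/= sumr_const card_ord.
  by rewrite mulNrn -[n%:R^-1 *+ _]mulr_natl.
rewrite prod_mean_sqr_sum => [|i j _ _ ij]; last first.
  rewrite (prod_mean_indep w_sum1 f (h := fun X => f (X j))).
    by rewrite f1 mul0r.
  by move=> X z; rewrite resample_other// eq_sym.
apply: (@le_trans _ _ (\sum_(i < p) 3 * n%:R^-1 ^+ 2)).
  apply: ler_sum => i _.
  by rewrite (prod_mean_coord w_sum1 i (fun z => f z ^+ 2)).
rewrite sumr_const card_ord -[3 * _ *+ _]mulr_natl.
by rewrite exprVn le_eqVlt; apply/orP; left; apply/eqP; ring.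
Qed.

(* Below 1, every fluctuation is at most its threshold in
   [top_eigenvalue_expansion]. *)
Definition defect (eta y : R) (X : config) : R :=
  (\sum_i row_avg R (X i) ^+ 2 - y) ^+ 2 / eta ^+ 2 +
  (\sum_i (\sum_j off_gram X i j) ^+ 2 + \sum_i \sum_j off_gram X i j ^+ 2
    + (\sum_i \sum_j off_gram X i j) ^+ 2) / (eta * p%:R) ^+ 2 +
  (\sum_i row_avg R (X i)) ^+ 2 / (eta ^+ 2 * p%:R).

Lemma mean_defect (eta : R) : 0 < eta -> (0 < p)%N -> p%:R / n%:R <= 1 :> R ->
  E (defect eta (p%:R / n%:R)) <= 10 / (n%:R * eta ^+ 2).
Proof.
move=> eta0 p0 pn1.
have P0 : 0 < p%:R :> R by rewrite ltr0n.
have N0 : 0 < n%:R :> R by rewrite ltr0n.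
have -> : E (defect eta (p%:R / n%:R)) =
  E (fun X => (\sum_i row_avg R (X i) ^+ 2 - p%:R / n%:R) ^+ 2) / eta ^+ 2 +
  (\sum_i E (fun X => (\sum_j off_gram X i j) ^+ 2) +
    \sum_i \sum_j E (fun X => off_gram X i j ^+ 2) +
   E (fun X => (\sum_i \sum_j off_gram X i j) ^+ 2)) / (eta * p%:R) ^+ 2 +
  E (fun X => (\sum_i row_avg R (X i)) ^+ 2) / (eta ^+ 2 * p%:R).
  have -> : \sum_i \sum_j E (fun X => off_gram X i j ^+ 2) =
      E (fun X => \sum_i \sum_j off_gram X i j ^+ 2).
    by rewrite prod_mean_sum; apply: eq_bigr => i _; rewrite prod_mean_sum.
  rewrite -prod_mean_sum -!prod_meanD !(mulrC (E _)) -!prod_meanZ -!prod_meanD.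
  by apply: eq_prod_mean => X; rewrite /defect; ring.
rewrite mean_sum_row_avg2.
have h1 := mean_sum_sqr_row_avg.
have h2 : \sum_i E (fun X => (\sum_j off_gram X i j) ^+ 2) <= p%:R ^+ 2 / n%:R.
  apply: (@le_trans _ _ (\sum_(i < p) (p%:R / n%:R))).
    by apply: ler_sum => i _; exact: mean_off_gram_row2.
  rewrite sumr_const card_ord -[_ / _ *+ _]mulr_natl.
  by rewrite le_eqVlt; apply/orP; left; apply/eqP; ring.
have h3 : \sum_i \sum_j E (fun X => off_gram X i j ^+ 2) <= p%:R ^+ 2 / n%:R.
  apply: (@le_trans _ _ (\sum_(i < p) \sum_(j < p) n%:R^-1)).
    apply: ler_sum => i _; apply: ler_sum => j _.
    have [<-|ij] := eqVneq i j; last by rewrite mean_off_gram2.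
    rewrite /off_gram eqxx; under eq_prod_mean do rewrite expr0n/=.
    by rewrite prod_mean_cst// invr_ge0.
  rewrite !sumr_const !card_ord -!mulrnA -[n%:R^-1 *+ _]mulr_natl natrM.
  by rewrite le_eqVlt; apply/orP; left; apply/eqP; ring.
have h4 := mean_sum_off_gram2.
(* The 10 is 3 for the squared averages, 1 + 1 + 4 for the three Gram terms, and 1 for the sum of
   averages. *)
have -> : 10 / (n%:R * eta ^+ 2) = 3 / n%:R / eta ^+ 2 + (p%:R ^+ 2 / n%:R +
   p%:R ^+ 2 / n%:R + 4 * p%:R ^+ 2 / n%:R) / (eta * p%:R) ^+ 2 +
   p%:R / n%:R / (eta ^+ 2 * p%:R) :> R.
  by field; rewrite !gt_eqF.
apply: lerD => //; apply: lerD.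
  rewrite ler_wpM2r ?invr_ge0 ?sqr_ge0//; apply: le_trans h1 _.
  have -> : 3 * p%:R / n%:R ^+ 2 = 3 / n%:R * (p%:R / n%:R) :> R by field;
    rewrite gt_eqF.
  by rewrite ler_piMr// divr_ge0// ltW.
by rewrite ler_wpM2r ?invr_ge0 ?sqr_ge0// !lerD.
Qed.

End MatrixMoments.

(** * Fluctuations of the top eigenvalue *)

Section FiniteSize.
Variables (R : realType) (n : nat) (C : {vspace 'rV['F_2]_n}) (p : nat).
Hypotheses (dualC : (5%:R%:E <= dual_distance R C)%E) (n_gt0 : (0 < n)%N)
  (p_gt0 : (0 < p)%N).

Local Notation w := (code_weight R C).
Local Notation E := (@prod_mean R 'rV['F_2]_n 'I_p w).
Local Notation config := {ffun 'I_p -> 'rV['F_2]_n}.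
Implicit Types (X : config) (i j k l : 'I_p).

Definition config_mx X : 'M['F_2]_(p, n) := \matrix_(i, k) X i 0 k.

Lemma code_gramE X i j : code_gram R (config_mx X) i j =
  1 - row_avg R (X i) - row_avg R (X j) + (i == j)%:R + off_gram R X i j.
Proof.
have nR0 : n%:R != 0 :> R by rewrite pnatr_eq0 -lt0n.
transitivity (1 - row_avg R (X i) - row_avg R (X j) + row_gram R (X i) (X j)).
  rewrite !mxE !row_avgE /row_gram.
  transitivity (n%:R^-1 * \sum_k (1 - eps R (X i) k) * (1 - eps R (X j) k)).
    rewrite [LHS]big_distrr [RHS]big_distrr/=; apply: eq_bigr => k _.
    by rewrite !mxE !natr_sgn /eps; field.
  transitivity (n%:R^-1 * (\sum_(k < n) (1 + - 1 * eps R (X i) k + - 1 * eps R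
    (X j) k +
     eps R (X i) k * eps R (X j) k))).
    by congr (_ * _); apply: eq_bigr => k _; ring.
  by rewrite !big_split/= -!big_distrr/= sum1_n; field.
rewrite /off_gram; case: eqVneq => [->|_]; last by rewrite addr0.
by rewrite row_gram_self// addr0.
Qed.

(** I plus [off_gram] is the Gram matrix G, whose form is 1/n times a sum of squares over the
    columns. *)
Lemma off_gram_psd X (x : 'I_p -> R) :
  0 <= \sum_i x i ^+ 2 + quad (off_gram R X) x.
Proof.
have -> : \sum_i x i ^+ 2 + quad (off_gram R X) x =
   \sum_i \sum_j x i * row_gram R (X i) (X j) * x j.
  rewrite /quad -big_split/=; apply: eq_bigr => i _.
  rewrite (bigD1 i)//= [in RHS](bigD1 i)//= /off_gram eqxx row_gram_self//.
  rewrite mulr0 mul0r add0r mulr1 -expr2; congr (_ + _).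
  by apply: eq_bigr => j; rewrite eq_sym => /negbTE ->.
have -> : \sum_i \sum_j x i * row_gram R (X i) (X j) * x j =
    n%:R^-1 * \sum_(k < n) (\sum_i x i * eps R (X i) k) ^+ 2.
  transitivity (\sum_i \sum_j \sum_(k < n)
      n%:R^-1 * ((x i * eps R (X i) k) * (x j * eps R (X j) k))).
    apply: eq_bigr => i _; apply: eq_bigr => j _.
    rewrite /row_gram.
    transitivity (n%:R^-1 * x i * x j * \sum_k eps R (X i) k * eps R (X j) k).
      by ring.
    by rewrite big_distrr/=; apply: eq_bigr => k _; ring.
  rewrite big_distrr/=; under eq_bigr => i _ do rewrite exchange_big/=.
  rewrite exchange_big/=; apply: eq_bigr => k _.
  rewrite expr2 big_distrl big_distrr/=; apply: eq_bigr => i _.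
  by rewrite !big_distrr.
by rewrite mulr_ge0// sumr_ge0// => k _; exact: sqr_ge0.
Qed.

Definition top X : R :=
  largest_eigenvalue (code_gram R (config_mx X)) - (p%:R + 1 + p%:R / n%:R).

Definition signed_sum X : R := coord_sum (fun u => - 2 * row_avg R u) X.

(** All summands of [defect] are nonnegative, so a total below 1 puts each fluctuation under the
    threshold demanded by [top_eigenvalue_expansion]. *)
Lemma top_approx X (e : R) : p%:R / n%:R < 1 :> R -> 0 < e -> e <= 1 ->
  2 <= e / 20 * p%:R -> defect (e / 20) (p%:R / n%:R) X < 1 ->
  `|top X - signed_sum X| <= e.
Proof.
move=> pn1 e0 e1 pbig.
set eta := e / 20 in pbig *.
have eta0 : 0 < eta by rewrite divr_gt0.
have P0 : 0 < p%:R :> R by rewrite ltr0n.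
have N0 : 0 < n%:R :> R by rewrite ltr0n.
rewrite /defect; set t1 := _ / eta ^+ 2; set t3 := _ / (eta ^+ 2 * p%:R).
set A1 := \sum_i (\sum_j off_gram R X i j) ^+ 2.
set A2 := \sum_i \sum_j off_gram R X i j ^+ 2.
set A3 := (\sum_i \sum_j off_gram R X i j) ^+ 2.
have t1_ge0 : 0 <= t1 by rewrite divr_ge0 ?sqr_ge0.
have t3_ge0 : 0 <= t3.
  by rewrite divr_ge0 ?sqr_ge0// mulr_ge0 ?sqr_ge0.
have A1_ge0 : 0 <= A1 by apply: sumr_ge0 => i _; exact: sqr_ge0.
have A2_ge0 : 0 <= A2.
  by apply: sumr_ge0 => i _; apply: sumr_ge0 => j _; exact: sqr_ge0.
have A3_ge0 : 0 <= A3 by exact: sqr_ge0.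
have etaP2 : 0 < (eta * p%:R) ^+ 2 by rewrite exprn_gt0// mulr_gt0.
move=> small.
have A_ge0 : 0 <= (A1 + A2 + A3) / (eta * p%:R) ^+ 2.
  by rewrite divr_ge0 ?sqr_ge0// !addr_ge0.
have A_le : A1 + A2 + A3 <= (eta * p%:R) ^+ 2.
  by rewrite -[leRHS]mul1r -ler_pdivrMr//; lra.
have sqr_norm (u v : R) : 0 <= v -> u ^+ 2 <= v ^+ 2 -> `|u| <= v.
  move=> v0; rewrite -(real_normK (num_real u)) ler_sqr ?nnegrE//.
have gramT : (code_gram R (config_mx X))^T = code_gram R (config_mx X).
  by apply/matrixP => i j; rewrite mxE !code_gramE off_gramC (eq_sym i j); ring.
have [lam_ge lam_le] := largest_eigenvalueP p_gt0 gramT.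
have quadE x : quad (fun i j => code_gram R (config_mx X) i j) x =
  quad (fun i j => 1 - row_avg R (X i) - row_avg R (X j) + (i == j)%:R
    + off_gram R X i j) x.
  by apply: eq_bigr => i _; apply: eq_bigr => j _; rewrite code_gramE.
have -> : top X - signed_sum X = largest_eigenvalue (code_gram R (config_mx X))
    - (p%:R + 1 + p%:R / n%:R) + 2 * \sum_i row_avg R (X i).
  by rewrite /top /signed_sum /coord_sum -big_distrr/=; ring.
apply: (@top_eigenvalue_expansion R p (fun i => row_avg R (X i)) (off_gram R
  X)) => //.
- by rewrite divr_gt0.
- exact: off_gramC.
- exact: off_gram_psd.
- by move=> x; rewrite -quadE.
- by move=> b hb; apply: lam_le => x; rewrite quadE.
- apply: sqr_norm; first exact: ltW.
  by rewrite -[leRHS]mul1r -ler_pdivrMr ?exprn_gt0//; rewrite -/t1; lra.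
- by rewrite -/A1 -/eta; lra.
- by rewrite -/A2 -/eta; lra.
- apply: sqr_norm; first by rewrite ltW// mulr_gt0.
  by rewrite -/A3 -/eta; lra.
- by rewrite -[leRHS]mul1r -ler_pdivrMr ?mulr_gt0 ?exprn_gt0// -/t3; lra.
Qed.

Lemma defect_ge0 (eta y : R) X : 0 <= eta -> 0 <= defect eta y X.
Proof.
move=> eta0; rewrite /defect; apply: addr_ge0; first apply: addr_ge0.
- by rewrite divr_ge0 ?sqr_ge0.
- rewrite divr_ge0 ?sqr_ge0// !addr_ge0 ?sqr_ge0//.
    by apply: sumr_ge0 => i _; exact: sqr_ge0.
  by apply: sumr_ge0 => i _; apply: sumr_ge0 => j _; exact: sqr_ge0.
- by rewrite divr_ge0 ?sqr_ge0// mulr_ge0 ?sqr_ge0.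
Qed.

Lemma top_sandwich (x e : R) : p%:R / n%:R < 1 :> R -> 0 < e -> e <= 1 ->
  2 <= e / 20 * p%:R ->
  E (fun X => (signed_sum X <= x - e)%R%:R) - 10 / (n%:R * (e / 20) ^+ 2) <=
    E (fun X => (top X <= x)%R%:R) <=
  E (fun X => (signed_sum X <= x + e)%R%:R) + 10 / (n%:R * (e / 20) ^+ 2).
Proof.
move=> pn1 e0 e1 pbig; have eta0 : 0 < e / 20 by rewrite divr_gt0.
have Ed := mean_defect dualC n_gt0 eta0 p_gt0 (ltW pn1).
have w0 := @code_weight_ge0 R n C.
(* Markov's inequality in pointwise form: where [defect] is at least 1 it dominates any indicator,
   elsewhere the comparison of [s1] and [s2] holds. *)
have split X (s1 s2 : R) : (defect (e / 20) (p%:R / n%:R) X < 1 -> s1 <= s2) ->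
   forall t : R, (s2 <= t)%R%:R <= (s1 <= t)%R%:R + defect (e / 20) (p%:R /
     n%:R) X :> R.
  move=> s12 t; have d0 := defect_ge0 (p%:R / n%:R) X (ltW eta0).
  have [d1|d1] := leP 1 (defect (e / 20) (p%:R / n%:R) X).
    by rewrite -[leLHS]add0r lerD// (le_trans _ d1)// lern1 leq_b1.
  have [s2t|_] := leP s2 t; last by rewrite addr_ge0.
  by rewrite (le_trans (s12 d1) s2t) lerDl.
apply/andP; split.
  rewrite lerBlDr;
    apply: (@le_trans _ _ (E (fun X => (top X <= x)%R%:R) + E (defect (e / 20)
      (p%:R / n%:R)))); last first.
    by rewrite lerD2l.
  rewrite -prod_meanD; apply: ler_prod_mean => // X.
  have -> : (signed_sum X <= x - e) = (signed_sum X + e <= x) by rewrite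
    lerBrDr.
  apply: split => /(top_approx pn1 e0 e1 pbig).
  by rewrite ler_norml => /andP[_]; lra.
apply: (@le_trans _ _ (E (fun X => (signed_sum X <= x + e)%R%:R) + E (defect
  (e / 20) (p%:R / n%:R)))); last first.
  by rewrite lerD2l.
rewrite -prod_meanD; apply: ler_prod_mean => // X.
have -> : (signed_sum X <= x + e) = (signed_sum X - e <= x) by rewrite lerBlDr.
apply: split => /(top_approx pn1 e0 e1 pbig).
by rewrite ler_norml => /andP[+ _]; lra.
Qed.

Lemma signed_sum_clt_data : clt_data 'I_p w (fun u => - 2 * row_avg R u)
  (4 / n%:R) (Num.sqrt (4 * (p%:R / n%:R))).
Proof.
have N0 : 0 < n%:R :> R by rewrite ltr0n.
split; [exact: code_weight_ge0|exact: code_weight_sum1|by rewrite divr_gt0|].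
split.
- rewrite card_ord sqr_sqrtr; first by ring.
  by rewrite mulr_ge0// divr_ge0.
- by rewrite meanZ mean_row_avg// mulr0.
- under eq_mean do rewrite exprMn.
  by rewrite meanZ mean_row_avg2//; ring.
- under eq_mean do rewrite exprMn.
  rewrite meanZ; apply: le_trans (ler_wpM2l _ (mean_row_avg4 dualC n_gt0)) _.
    by rewrite exprn_even_ge0.
  by rewrite le_eqVlt; apply/orP; left; apply/eqP; field; rewrite gt_eqF.
Qed.

End FiniteSize.

(** * Transfer to the probability space *)

(** The error [e] is spent in four quarters: the shift of [x], the ramp width, the Stein error and
    the Markov error. The threshold is chosen before the code, which gives uniformity. *)
Lemma top_cdf_approx (R : realType) (y x e : R) : 0 < y -> y < 1 -> 0 < e ->
  exists N : R, forall (n p : nat) (C : {vspace 'rV['F_2]_n}),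
    (5%:R%:E <= dual_distance R C)%E -> (0 < n)%N -> (0 < p)%N ->
    p%:R / n%:R = y -> N <= n%:R ->
    `|prod_mean (code_weight R C) (fun X : {ffun 'I_p -> 'rV['F_2]_n} =>
        (top R X <= x)%R%:R) - gauss_cdf (Num.sqrt (4 * y)) x| <= e.
Proof.
move=> y0 y1 e0; set s := Num.sqrt (4 * y).
have s0 : 0 < s by rewrite sqrtr_gt0 mulr_gt0.
have pk0 : 0 <= normal_peak s := normal_peak_ge0 s.
(* Shifting [x] by [h] moves the Gaussian distribution function by at most
   [normal_peak s * h <= e / 4]; the cap at 1 is what [top_sandwich] asks of its tolerance. *)
pose h := Num.min 1 (e / (4 * (normal_peak s + 1))).
have h0 : 0 < h.
  by rewrite lt_min ltr01/= divr_gt0// mulr_gt0// ltr_wpDl.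
have h1 : h <= 1 by rewrite ge_min lexx.
have hpk : normal_peak s * h <= e / 4.
  have : h <= e / (4 * (normal_peak s + 1)) by rewrite ge_min lexx orbT.
  rewrite ler_pdivlMr; last by rewrite mulr_gt0// ltr_wpDl.
  by move=> ?; nra.
have e4 : 0 < e / 4 by rewrite divr_gt0.
have [D1 D1_ge0 HD1] := clt_cdf s0 (x + h) e4.
have [D2 D2_ge0 HD2] := clt_cdf s0 (x - h) e4.
pose D := D1 + D2 + 1.
have D0 : 0 < D by rewrite ltr_wpDl// addr_ge0.
have eta0 : 0 < h / 20 by rewrite divr_gt0.
(* Since p = y n, [N1] ensures [2 <= h / 20 * p]; [N2] brings the Markov error below [e / 4], and
   [N3] does so for [D * Num.sqrt (4 / n)]. *)
pose N1 := 2 / (h / 20 * y).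
pose N2 := 40 / (e * (h / 20) ^+ 2).
pose N3 := 4 / (e / (4 * D)) ^+ 2.
exists (N1 + N2 + N3) => n p C dualC n0 p0 pn nN.
have N0 : 0 < n%:R :> R by rewrite ltr0n.
have N1_ge0 : 0 <= N1 by rewrite divr_ge0// mulr_ge0// ltW.
have N2_ge0 : 0 <= N2 by rewrite divr_ge0// mulr_ge0 ?sqr_ge0// ltW.
have N3_ge0 : 0 <= N3 by rewrite divr_ge0 ?sqr_ge0.
have pE : p%:R = y * n%:R by rewrite -pn mulfVK// gt_eqF.
have c1 : 2 <= h / 20 * p%:R.
  rewrite pE mulrA -ler_pdivrMl ?mulr_gt0//.
  have -> : (h / 20 * y)^-1 * 2 = N1 by rewrite mulrC.
  lra.
have c2 : 10 / (n%:R * (h / 20) ^+ 2) <= e / 4.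
  have : N2 <= n%:R by lra.
  rewrite /N2 ler_pdivrMr ?mulr_gt0 ?exprn_gt0// => c2'.
  rewrite ler_pdivrMr ?mulr_gt0 ?exprn_gt0//; lra.
have c3 : D * Num.sqrt (4 / n%:R) <= e / 4.
  have eD : 0 <= e / (4 * D) by rewrite divr_ge0 ?mulr_ge0// ltW.
  have : Num.sqrt (4 / n%:R) <= e / (4 * D).
    rewrite -[leRHS](ger0_norm eD) -sqrtr_sqr ler_wsqrtr//.
    have : N3 <= n%:R by lra.
    have eD2 : 0 < (e / (4 * D)) ^+ 2 by rewrite exprn_gt0// divr_gt0//
      mulr_gt0.
    by rewrite /N3 ler_pdivrMr// => ?; rewrite ler_pdivrMr// mulrC.
  by rewrite ler_pdivlMr ?mulr_gt0// => ?; lra.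
have pn1 : p%:R / n%:R < 1 :> R by rewrite pn.
have /andP[lo hi] := top_sandwich dualC n0 p0 x pn1 h0 h1 c1.
have cd := signed_sum_clt_data p dualC n0; rewrite pn in cd.
have sq0 := sqrtr_ge0 (4 / n%:R : R).
have := HD1 _ _ _ _ _ cd; have := HD2 _ _ _ _ _ cd.
have := gauss_cdf_lipschitz s0 (x + h) x.
have := gauss_cdf_lipschitz s0 (x - h) x.
have -> : x + h - x = h by ring.
have -> : x - h - x = - h by ring.
rewrite normrN (gtr0_norm h0) !ler_norml => /andP[a1 a2] /andP[a3 a4].
move=> /andP[b1 b2] /andP[b3 b4].
have D1D : D1 * Num.sqrt (4 / n%:R) <= D * Num.sqrt (4 / n%:R).
  by rewrite ler_wpM2r// /D; lra.
have D2D : D2 * Num.sqrt (4 / n%:R) <= D * Num.sqrt (4 / n%:R).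
  by rewrite ler_wpM2r// /D; lra.
rewrite /signed_sum in lo hi.
apply/andP; split; lra.
Qed.

Section Transfer.
Variables (R : realType) (n p : nat) (C : {vspace 'rV['F_2]_n}).
Variables (d : measure_display) (T : measurableType d) (P : probability T R).
Variable Phi : T -> 'M['F_2]_(p, n).
Hypothesis iidPhi : iid_uniform_rows P C Phi.

Local Notation config := {ffun 'I_p -> 'rV['F_2]_n}.

Definition rows (M : 'M['F_2]_(p, n)) : config := [ffun i => row i M].

Lemma config_mx_rows M : config_mx (rows M) = M.
Proof. by apply/matrixP => i j; rewrite !mxE ffunE mxE. Qed.

Lemma rows_eqE (X : config) :
  [set t | rows (Phi t) = X] = \bigcap_(i in [set: 'I_p]) [set t | row i (Phi
    t) = X i].
Proof.
apply/seteqP; split => t /= H.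
  by move=> i _; rewrite /= -H ffunE.
by apply/ffunP => i; rewrite ffunE; exact: H.
Qed.

Lemma measurable_rows_eq (X : config) : measurable [set t | rows (Phi t) = X].
Proof.
have [mPhi _ _] := iidPhi.
by rewrite rows_eqE; apply: fin_bigcap_measurable => // i _; exact: mPhi.
Qed.

(** Independence is used at the full index set with singleton events; this is where the abstract law
    becomes the product weight. *)
Lemma prob_rows_eq (X : config) :
  P [set t | rows (Phi t) = X] = (\prod_i code_weight R C (X i))%:E.
Proof.
have [_ uPhi indPhi] := iidPhi.
have := indPhi [set: 'I_p]%SET (fun i => [set X i]).
rewrite (_ : \bigcap_(i in _) _ = [set t | rows (Phi t) = X]); last first.
  rewrite rows_eqE; apply/seteqP; split => t H i _; apply: H => //=.
  by rewrite inE.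
move=> ->; rewrite -prodEFin; apply: eq_big => [i|i _]; first by rewrite inE.
exact: uPhi.
Qed.

Lemma rows_event (B : pred config) : [set t | B (rows (Phi t))] =
  \bigcup_(X in [set` B]) [set t | rows (Phi t) = X].
Proof.
apply/seteqP; split => [t /= Bt|t [X BX e]]; last by rewrite /= e.
by exists (rows (Phi t)).
Qed.

Lemma measurable_rows_event (B : pred config) :
  measurable [set t | B (rows (Phi t))].
Proof.
by rewrite rows_event; apply: fin_bigcup_measurable => // X _;
  exact: measurable_rows_eq.
Qed.

Lemma prob_rows_event (B : pred config) : P [set t | B (rows (Phi t))] =
  (prod_mean (code_weight R C) (fun X : config => (B X)%:R))%:E.
Proof.
rewrite rows_event measure_fin_bigcup//; last 2 first.
- by move=> X Y _ _ [t [/= -> ->]].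
- by move=> X _; exact: measurable_rows_eq.
rewrite -(@bigfs _ _ _ _ (index_enum config) B)//; last 2 first.
- exact: index_enum_uniq.
- by move=> X _; rewrite mem_index_enum.
rewrite (eq_bigr (fun X : config => (\prod_i code_weight R C (X i))%:E));
  last first.
  by move=> X _; exact: prob_rows_eq.
rewrite sumEFin /prod_mean big_mkcond/=; congr EFin; apply: eq_bigr => X _.
by case: (B X); rewrite ?mulr1 ?mulr0.
Qed.

Lemma prob_top (x y : R) : p%:R / n%:R = y ->
  P ((fun t => largest_eigenvalue (code_gram R (Phi t)) - (p%:R + 1 + y)) @^-1`
       `]-oo, x]) =
  (prod_mean (code_weight R C) (fun X : config => (top R X <= x)%R%:R))%:E.
Proof.
move=> <-; rewrite -prob_rows_event; congr (P _); apply/seteqP.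
by split => t /=; rewrite /top config_mx_rows in_itv.
Qed.

(** The matrix takes finitely many values, each on a measurable set, so every function of it is
    measurable, the largest eigenvalue included. *)
Lemma measurable_top (y : R) : measurable_fun [set: T]
  (fun t => largest_eigenvalue (code_gram R (Phi t)) - (p%:R + 1 + y)).
Proof.
move=> _ Y mY; rewrite setTI.
set f := (X in X @^-1` _).
rewrite (_ : f @^-1` Y = [set t | [pred X |
    `[< Y (largest_eigenvalue (code_gram R (config_mx X)) - (p%:R + 1 + y)) >]
      ] (rows (Phi t))]).
  exact: measurable_rows_event.
by apply/seteqP; split => t /=; rewrite config_mx_rows => /asboolP.
Qed.

End Transfer.

Unset Implicit Arguments.
Set Strict Implicit.
Set Printing Implicit Defensive.

Theorem theorem3 (R : realType) (y : R) (hy0 : 0 < y) (hy1 : y < 1)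
    (p : nat -> nat)
    (hp : forall n, admissible_lengths y n ->
      (0 < p n)%N /\ (p n)%:R / n%:R = y)
    (C : forall n : nat, {vspace 'rV['F_2]_n})
    (hC : forall n, admissible_lengths y n ->
      (5%:R%:E <= dual_distance R (C n))%E)
    (d : nat -> measure_display)
    (T : forall n : nat, measurableType (d n))
    (P : forall n : nat, probability (T n) R)
    (Phi : forall n : nat, T n -> 'M['F_2]_(p n, n))
    (hPhi : forall n, admissible_lengths y n ->
      iid_uniform_rows (P n) (C n) (Phi n)) :
  cvg_in_distribution (within (admissible_lengths y) \oo) P
    (fun n w => largest_eigenvalue (code_gram R (Phi n w))
                - ((p n)%:R + 1 + y))
    (normal_prob 0 (Num.sqrt (4 * y))).
Proof.
split=> [|x _].
  rewrite near_withinE; apply: nearW => n /hPhi iidn.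
  exact: measurable_top iidn y.
rewrite -[X in _ --> X]fineK ?fin_num_measure//; apply/fine_cvgP; split.
  rewrite near_withinE; apply: nearW => n An; have [_ pn] := hp n An.
  by rewrite (prob_top (hPhi n An) x pn).
apply/cvgrPdist_le => e e0; rewrite near_withinE.
have [N HN] := top_cdf_approx x hy0 hy1 e0.
near=> n => An; have [p0 pn] := hp n An; have [n0 _] := An.
rewrite /= (prob_top (hPhi n An) x pn) distrC.
apply: HN => //; first exact: hC.
by near: n; exact: nbhs_infty_ger.
Unshelve. all: by end_near. Qed.
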